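(* Let $p\ge 1$ be an integer, and let $f:\mathbb{R}^n\to\mathbb{R}$ be $p$-times differentiable with $\|\nabla^p f(x)-\nabla^p f(y)\|\le L\|x-y\|$ for all $x,y\in\mathbb{R}^n$, and bounded from below: $f(x)\ge f_{low}$ for all $x\in\mathbb{R}^n$. Let $\epsilon>0$, $z_0\in\mathbb{R}^n$, $L_0>0$, $m\in\mathbb{N}\setminus\{0\}$, and let $K(\epsilon)\in\mathbb{N}\cup\{+\infty\}$ denote the termination time of Algorithm 2 (defined in the context), i.e. the smallest index such that $\|\nabla f(z_{K(\epsilon)})\|\le\epsilon$. Then, with $L_{\max}=\max\{L_0,2L\}$, $$K(\epsilon)\le 1+\frac{2^7\cdot\left(3\cdot 11(p+1)\cdot L_{\max}\right)^{1/p}(p+1)!\,(f(z_0)-f_{low})}{m^{(p-1)/p}}\,\epsilon^{-\frac{p+1}{p}}+\log_2\left(\frac{L_{\max}}{L_0}\right).$$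
   Context: Notation. $\|\cdot\|$ is the Euclidean norm on $\mathbb{R}^n$; $e_1,\dots,e_n$ is the canonical basis. $\nabla^q f(x)$ is the $q$th derivative, a symmetric $q$-linear form ($\nabla^0 f=f$; $\nabla f(x)$ is identified with the gradient vector). For a $q$-linear form $T$ (not necessarily symmetric), $\|T\|=\max_{\|h_1\|,\dots,\|h_q\|\le 1}|T[h_1,\dots,h_q]|$ and $T[h]^q=T[h,\dots,h]$. For a symmetric $(q-1)$-linear form $E$ and a vector $e$, $E\otimes e$ is the $q$-linear form $(E\otimes e)[h_1,\dots,h_q]=E[h_1,\dots,h_{q-1}]\langle e,h_q\rangle$ (for $q=1$, $E$ is a scalar). Algorithm 1: $(z^+,\alpha)=\texttt{LazyTensorSteps}(x,T,\sigma,m,\epsilon)$, where $T$ is a $p$-linear form, $\sigma>0$, $m\ge1$ an integer, $\epsilon>0$. Step 0: set $x_0:=x$, $\tilde x_0:=x$, $t:=0$. Step 1: if $t=m$, stop and return $(\tilde x_t,\texttt{success})$. Step 2: let $M_{x_t,\sigma,p}(y)=f(x_t)+\sum_{i=1}^{p-1}\frac{1}{i!}\nabla^i f(x_t)[y-x_t]^i+\frac1{p!}T[y-x_t]^p+\frac{\sigma}{(p+1)!}\|y-x_t\|^{p+1}$; compute any $x_{t+1}$ with $M_{x_t,\sigma,p}(x_{t+1})\le f(x_t)$ and $\|\nabla M_{x_t,\sigma,p}(x_{t+1})\|\le\frac{\sigma}{2p!}\|x_{t+1}-x_t\|^p$. Let $\tilde x_{t+1}$ be a minimizer of $f$ over $\{\tilde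 x_t,x_{t+1}\}$. Step 3: if $\|\nabla f(x_{t+1})\|\le\epsilon$, stop and return $(x_{t+1},\texttt{solution})$. Step 4: if $f(x_0)-f(\tilde x_{t+1})\ge\frac{\epsilon^{(p+1)/p}}{2^6\cdot3^{1/p}\cdot\sigma^{1/p}\cdot(p+1)!}(t+1)$, set $t:=t+1$ and go to Step 1; otherwise stop and return $(\tilde x_{t+1},\texttt{halt})$. Algorithm 2. Step 0: given $z_0\in\mathbb{R}^n$, $L_0>0$, $\epsilon>0$, integer $m\ge1$, set $k:=0$. Step 1: if $\|\nabla f(z_k)\|\le\epsilon$, stop. Step 2: set $\sigma_k=11(p+1)L_km$ and $h_k=\frac{4}{\sigma_k\sqrt n}\Bigl[\frac{\sigma_k^p\,\epsilon^{(p+1)/p}}{(8(p+1))^p\cdot2^7\cdot3^{1/p}\sigma_k^{1/p}}\Bigr]^{\frac1{p+1}}$, and compute $T_k=\sum_{i=1}^n\Bigl(\frac{\nabla^{p-1}f(z_k+h_ke_i)-\nabla^{p-1}f(z_k)}{h_k}\Bigr)\otimes e_i$. Step 3: $(z_{k+1},\alpha_k)=\texttt{LazyTensorSteps}(z_k,T_k,\sigma_k,m,\epsilon)$. Step 4: $L_{k+1}=2L_k$ if $\alpha_k=\texttt{halt}$; $L_{k+1}=L_k$ if $\alpha_k=\texttt{solution}$; $L_{k+1}=L_k/2$ if $\alpha_k=\texttt{success}$. Step 5: $k:=k+1$, go to Step 1. *)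

(* Defs.v *)
From mathcomp Require Import all_boot all_order all_algebra.
From mathcomp Require Import all_classical all_reals all_analysis.
Set Implicit Arguments.
Unset Strict Implicit.
Unset Printing Implicit Defensive.
Import Order.TTheory GRing.Theory Num.Theory.
Import numFieldNormedType.Exports.
Local Open Scope classical_set_scope.
Local Open Scope ring_scope.

Section EuclideanSpace.
Context {R : realType} {n : nat}.
Local Notation V := 'rV[R]_n.

Definition dot (u v : V) : R := \sum_(i < n) u 0 i * v 0 i.

(* The library norm [`|v|] on matrices is the sup norm; only the topology is
   taken from it. *)
Definition enorm (v : V) : R := Num.sqrt (dot v v).

Definition basis_vec (i : 'I_n) : V := delta_mx 0 i.

(* The underlying functions of q-linear forms.  Multilinearity is not part of
   the type: it holds for the forms [nabla q f x] and [fd_form] below whenever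
   f is differentiable often enough. *)
Definition form (q : nat) := q.-tuple V -> R.

Definition opnorm (q : nat) (T : form q) : R :=
  sup [set `|T h| | h in [set h | forall i, enorm (tnth h i) <= 1]].

Definition diag_eval (q : nat) (T : form q) (v : V) : R :=
  T [tuple of nseq q v].

(* (E (x) e)[h_1, ..., h_q] = E[h_1, ..., h_(q-1)] <e, h_q>, for q > 0 *)
Definition form_tensor (q : nat) (E : form q.-1) (e : V) : form q :=
  fun h => E [tuple h`_i | i < q.-1] * dot e h`_q.-1.

(* [nabla q f x] is the q-th iterated Frechet derivative,
   nabla^(q+1) f(x)[v, h] = (d (nabla^q f)(x) v)[h]; the differential of the
   form-valued map is computed by evaluating the form at h. *)
Fixpoint nabla (q : nat) (f : V -> R) (x : V) {struct q} : form q :=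
  match q return form q with
  | 0 => fun _ => f x
  | q'.+1 => fun h =>
      'd (fun y => @nabla q' f y [tuple of behead h]) x (thead h)
  end.
Arguments nabla : clear implicits.

(* Forms live in a finite-dimensional space, so differentiability of the map
   [nabla q f] means differentiability of all its evaluations. *)
Definition times_differentiable (p : nat) (f : V -> R) : Prop :=
  forall q : nat, (q < p)%N -> forall (h : q.-tuple V) (x : V),
    differentiable (fun y => nabla q f y h) x.

Definition grad (f : V -> R) (x : V) : V := \row_i 'd f x (basis_vec i).

End EuclideanSpace.
Arguments nabla {R n} q f x h.

Section LazyTensorSteps.
Context {R : realType} {n : nat}.
Local Notation V := 'rV[R]_n.

Variant outcome := Success | Solution | Halt.

Context (f : V -> R) (p : nat).

Definition model (T : form p) (sigma : R) (x y : V) : R :=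
  f x + \sum_(1 <= i < p) (i`!%:R)^-1 * diag_eval (nabla i f x) (y - x)
  + (p`!%:R)^-1 * diag_eval T (y - x)
  + sigma / (p.+1)`!%:R * enorm (y - x) ^+ p.+1.

Definition tensor_step (T : form p) (sigma : R) (x x' : V) : Prop :=
  model T sigma x x' <= f x /\
  enorm (grad (model T sigma x) x')
    <= sigma / (2 * p`!%:R) * enorm (x' - x) ^+ p.

Definition minimizer_of_two (u v w : V) : Prop :=
  (w = u \/ w = v) /\ f w <= f u /\ f w <= f v.

Definition sufficient_decrease (sigma eps : R) (x0 xt' : V) (t : nat) : Prop :=
  f x0 - f xt' >=
    eps `^ (p.+1%:R / p%:R)
    / (2 ^+ 6 * 3 `^ p%:R^-1 * sigma `^ p%:R^-1 * (p.+1)`!%:R) * t.+1%:R.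

(* [lazy_loop x0 T sigma m eps t x xt z a]: started in Step 1 with counter t,
   iterate x = x_t and best point xt (x_t with a tilde), some execution
   returns (z, a).  It is a relation because x_(t+1), and in case of a tie the
   best point, are arbitrary choices. *)
Inductive lazy_loop (x0 : V) (T : form p) (sigma : R) (m : nat) (eps : R) :
    nat -> V -> V -> V -> outcome -> Prop :=
| LoopSuccess (x xt : V) :
    lazy_loop x0 T sigma m eps m x xt xt Success
| LoopSolution (t : nat) (x xt x' xt' : V) :
    t <> m -> tensor_step T sigma x x' -> minimizer_of_two xt x' xt' ->
    enorm (grad f x') <= eps ->
    lazy_loop x0 T sigma m eps t x xt x' Solution
| LoopHalt (t : nat) (x xt x' xt' : V) :
    t <> m -> tensor_step T sigma x x' -> minimizer_of_two xt x' xt' ->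
    ~ enorm (grad f x') <= eps ->
    ~ sufficient_decrease sigma eps x0 xt' t ->
    lazy_loop x0 T sigma m eps t x xt xt' Halt
| LoopNext (t : nat) (x xt x' xt' z : V) (a : outcome) :
    t <> m -> tensor_step T sigma x x' -> minimizer_of_two xt x' xt' ->
    ~ enorm (grad f x') <= eps ->
    sufficient_decrease sigma eps x0 xt' t ->
    lazy_loop x0 T sigma m eps t.+1 x' xt' z a ->
    lazy_loop x0 T sigma m eps t x xt z a.

Definition lazy_tensor_steps (x : V) (T : form p) (sigma : R) (m : nat)
    (eps : R) (z : V) (a : outcome) : Prop :=
  lazy_loop x T sigma m eps 0 x x z a.

Definition sigma_of (m : nat) (Lk : R) : R := 11 * p.+1%:R * Lk * m%:R.

Definition fd_stepsize (eps sigma : R) : R :=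
  4 / (sigma * Num.sqrt n%:R) *
  (sigma ^+ p * eps `^ (p.+1%:R / p%:R)
   / ((8 * p.+1%:R) ^+ p * 2 ^+ 7 * 3 `^ p%:R^-1 * sigma `^ p%:R^-1))
  `^ (p.+1%:R)^-1.

Definition fd_form (h : R) (z : V) : form p :=
  fun g => \sum_(i < n)
    form_tensor
      (fun g' => (nabla p.-1 f (z + h *: basis_vec i) g' - nabla p.-1 f z g')
                 / h)
      (basis_vec i) g.

Definition update_L (a : outcome) (Lk : R) : R :=
  match a with
  | Halt => 2 * Lk
  | Solution => Lk
  | Success => Lk / 2
  end.

(* [(z, L)] is an execution of the outer method.  Entries past the termination
   time are unconstrained. *)
Definition outer_run (eps : R) (m : nat) (z0 : V) (L0 : R)
    (z : nat -> V) (L : nat -> R) : Prop :=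
  z 0%N = z0 /\ L 0%N = L0 /\
  forall k : nat,
    (forall j : nat, (j <= k)%N -> ~ enorm (grad f (z j)) <= eps) ->
    exists a : outcome,
      let sigma := sigma_of m (L k) in
      lazy_tensor_steps (z k) (fd_form (fd_stepsize eps sigma) (z k))
        sigma m eps (z k.+1) a /\
      L k.+1 = update_L a (L k).

(* the least k with ||grad f(z_k)|| <= eps, and +oo if there is none *)
Definition termination_time (eps : R) (z : nat -> V) : \bar R :=
  ereal_inf [set k%:R%:E | k in [set k : nat | enorm (grad f (z k)) <= eps]].

End LazyTensorSteps.

Definition log2 {R : realType} (x : R) : R := ln x / ln 2.

(* Main.v *)
Require Import Defs.
From HB Require Import structures.
From mathcomp Require Import all_boot all_order all_algebra.
From mathcomp Require Import all_classical all_reals all_analysis.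
From mathcomp Require Import ring lra.
Set Implicit Arguments.
Unset Strict Implicit.
Unset Printing Implicit Defensive.
Import Order.TTheory GRing.Theory Num.Theory.
Import numFieldNormedType.Exports.
Local Open Scope classical_set_scope.
Local Open Scope ring_scope.

(* An inner run with the frozen tensor [T] sees the top derivative at [x_t] with
   error at most [L (d_t + delta)], where [d_t] is the length of the path from
   [x_0] to [x_t] and [delta] comes from the finite differences.  Taylor's theorem
   turns the two acceptance conditions of a step of length [r_t] into

     f(x_t) - f(x_(t+1)) >= (sigma - L) r_t^(p+1) / (p+1)!
                              - L (d_t + delta) r_t^p / p!,
     p! eps <= (L + 3/2 sigma) r_t^p + p L (d_t + delta) r_t^(p-1).

   If [sigma >= 11 (p+1) L m], the terms in [d_t], summed over at most [m] steps,
   are absorbed by the sum of the [r_t^(p+1)] (power means), so the decrease grows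
   linearly in [t] and the run cannot halt.  Hence [L_k] never exceeds
   [max (L_0, 2 L)]: the halts outnumber the successes by at most
   [log2 (L_max / L_0)], and every success decreases [f] by a fixed amount. *)

(** * Euclidean norm *)

Section Euclidean.
Context {R : realType} {n : nat}.
Implicit Types u v w : 'rV[R]_n.

Lemma dotC u v : dot u v = dot v u.
Proof. by apply: eq_bigr => i _; rewrite mulrC. Qed.

Lemma dotDl u v w : dot (u + v) w = dot u w + dot v w.
Proof. by rewrite /dot -big_split/=; apply: eq_bigr => i _; rewrite mxE mulrDl. Qed.

Lemma dotZl a u v : dot (a *: u) v = a * dot u v.
Proof. by rewrite /dot big_distrr/=; apply: eq_bigr => i _; rewrite mxE mulrA. Qed.

Lemma dotDr u v w : dot w (u + v) = dot w u + dot w v.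
Proof. by rewrite ![dot w _]dotC dotDl. Qed.

Lemma dotZr a u v : dot u (a *: v) = a * dot u v.
Proof. by rewrite ![dot u _]dotC dotZl. Qed.

Lemma dot_ge0 u : 0 <= dot u u.
Proof. by apply: sumr_ge0 => i _; rewrite -expr2 sqr_ge0. Qed.

Lemma dot_basis u i : dot u (basis_vec i) = u 0 i.
Proof.
rewrite /dot (bigD1 i)//= big1 ?addr0 => [|j ji]; rewrite !mxE !eqxx/= ?mulr1//.
by rewrite (negbTE ji) mulr0.
Qed.

Lemma enorm_ge0 u : 0 <= enorm u.
Proof. exact: sqrtr_ge0. Qed.

Lemma sqr_enorm u : enorm u ^+ 2 = dot u u.
Proof. by rewrite sqr_sqrtr// dot_ge0. Qed.

Lemma enorm_basis i : enorm (basis_vec i : 'rV[R]_n) = 1.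
Proof. by rewrite /enorm dot_basis mxE !eqxx sqrtr1. Qed.

Lemma enormZ a u : enorm (a *: u) = `|a| * enorm u.
Proof. by rewrite /enorm dotZl dotZr mulrA -expr2 sqrtrM ?sqr_ge0// sqrtr_sqr. Qed.

Lemma enorm0 : enorm (0 : 'rV[R]_n) = 0.
Proof. by rewrite -(scale0r 0) enormZ normr0 mul0r. Qed.

Lemma enormN u : enorm (- u) = enorm u.
Proof. by rewrite -scaleN1r enormZ normrN1 mul1r. Qed.

Lemma enorm_eq0 u : enorm u = 0 -> u = 0.
Proof.
move=> u0; have /eqP := sqr_enorm u; rewrite u0 expr0n/= eq_sym.
rewrite psumr_eq0 => [/allP s0|i _]; last by rewrite -expr2 sqr_ge0.
apply/rowP => i; rewrite mxE.
by have /eqP/eqP := s0 i (mem_index_enum _); rewrite mulf_eq0 orbb => /eqP.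
Qed.

(** The squared norm of [dot v v *: u - dot u v *: v] is nonnegative and equals [dot v v] times the
    defect of the squared inequality. *)
Lemma cauchy_schwarz u v : `|dot u v| <= enorm u * enorm v.
Proof.
have [/enorm_eq0 ->|v0] := eqVneq (enorm v) 0.
  by rewrite -[X in dot u X](scale0r u) dotZr mul0r normr0 mulr_ge0 ?enorm_ge0.
rewrite -[leLHS]ger0_norm// -ler_sqr ?nnegrE ?mulr_ge0 ?enorm_ge0//.
rewrite normr_id real_normK ?num_real// exprMn !sqr_enorm.
have := dot_ge0 (dot v v *: u - dot u v *: v).
rewrite -scaleNr !(dotDl, dotDr, dotZl, dotZr) (dotC v u).
have vv : 0 < dot v v by rewrite -sqr_enorm exprn_gt0// lt0r v0 enorm_ge0.
rewrite [leRHS](_ : _ = dot v v * (dot u u * dot v v - dot u v ^+ 2)).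
  by rewrite pmulr_rge0// subr_ge0.
ring.
Qed.

Lemma enormD u v : enorm (u + v) <= enorm u + enorm v.
Proof.
rewrite -ler_sqr ?nnegrE ?addr_ge0 ?enorm_ge0// sqrrD !sqr_enorm.
rewrite !(dotDl, dotDr) (dotC v u).
have := le_trans (ler_norm _) (cauchy_schwarz u v); lra.
Qed.

Lemma coord_le_enorm u i : `|u 0 i| <= enorm u.
Proof.
by have := cauchy_schwarz u (basis_vec i); rewrite dot_basis enorm_basis mulr1.
Qed.

(** Cauchy-Schwarz against the all-ones vector. This is the origin of the [Num.sqrt n%:R] that the
    finite-difference step size compensates. *)
Lemma sum_coord_le_enorm u : \sum_i `|u 0 i| <= Num.sqrt n%:R * enorm u.
Proof.
have := cauchy_schwarz (const_mx 1) (\row_i `|u 0 i|).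
have -> : enorm (\row_i `|u 0 i|) = enorm u.
  congr Num.sqrt; apply: eq_bigr => i _.
  by rewrite mxE -expr2 real_normK ?num_real.
have -> : enorm (const_mx 1 : 'rV[R]_n) = Num.sqrt n%:R.
  congr Num.sqrt; rewrite /dot (eq_bigr (fun=> 1)) => [|i _].
    by rewrite sumr_const card_ord.
  by rewrite mxE mulr1.
apply: le_trans; apply: le_trans (ler_norm _).
rewrite [leRHS](eq_bigr (fun i => `|u 0 i|))// => i _.
by rewrite !mxE mul1r.
Qed.

Lemma dot_le_norm u : dot u u <= n%:R * `|u| ^+ 2.
Proof.
apply: le_trans (ler_sum _ (_ : forall i, _ -> u 0 i * u 0 i <= `|u| ^+ 2)) _.
  move=> i _; rewrite -expr2 -real_normK ?num_real// ler_sqr ?nnegrE//.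
  by rewrite [leRHS]mx_normrE; exact: (le_bigmax _ (fun ij => `|u ij.1 ij.2|) (0, i)).
by rewrite sumr_const card_ord mulr_natl.
Qed.

End Euclidean.

(** * Taylor's theorem with a Lipschitz last derivative *)

Section RealTaylor.
Context {R : realType}.
Implicit Types (g dg : R -> R) (C t : R).

Let field_side (j : nat) : (j`!%:R != 0 :> R) && (1 + j%:R != 0 :> R).
Proof. by rewrite addrC natr1 !pnatr_eq0 -lt0n fact_gt0. Qed.

(** Mean value theorem for the difference [h] of majorant and [g], which vanishes at 0 and has
    nonnegative derivative on [[0, t]]. *)
Lemma le_of_derive_le g dg C (j : nat) t :
  (forall s : R, is_derive s 1 g (dg s)) -> g 0 = 0 -> 0 <= t ->
  (forall s, 0 <= s <= t -> dg s <= C * s ^+ j / j`!%:R) ->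
  g t <= C * t ^+ j.+1 / (j.+1)`!%:R.
Proof.
move=> dgP g0 t0 dgC.
pose h : R -> R := (C / (j.+1)`!%:R) *: (@id R) ^+ j.+1 - g.
have dh (s : R) : is_derive s 1 h (C * s ^+ j / j`!%:R - dg s).
  apply: is_derive_eq; rewrite /= scaler1 factS natrM /GRing.scale/=.
  by congr (_ - _); field; exact: field_side.
have ch : {within `[0, t], continuous h}.
  by apply: derivable_within_continuous => s _; exact: ex_derive.
have [c ct] := MVT_segment t0 (fun s _ => dh s) ch.
have -> : h 0 = 0 by rewrite /h !fctE g0 expr0n/= scaler0 subrr.
rewrite !subr0 => hE.
suff : 0 <= h t by rewrite /h !fctE subr_ge0 /GRing.scale/= mulrAC.
rewrite hE mulr_ge0// subr_ge0 dgC//.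
Qed.

Lemma norm_le_of_derive_le g dg C (j : nat) t :
  (forall s : R, is_derive s 1 g (dg s)) -> g 0 = 0 -> 0 <= t ->
  (forall s, 0 <= s <= t -> `|dg s| <= C * s ^+ j / j`!%:R) ->
  `|g t| <= C * t ^+ j.+1 / (j.+1)`!%:R.
Proof.
move=> dgP g0 t0 dgC; rewrite ler_norml lerNl; apply/andP; split.
  apply: (@le_of_derive_le (- g) (- dg)) => // [|s st].
    by rewrite fctE g0 oppr0.
  by apply: le_trans (dgC s st); rewrite fctE -normrN ler_norm.
by apply: (le_of_derive_le dgP) => // s st; apply: le_trans (dgC s st); exact: ler_norm.
Qed.

Lemma is_derive_taylor_sum (a : nat -> R) k t :
  is_derive t 1 (fun t => \sum_(i < k.+1) a i * t ^+ i / i`!%:R)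
                (\sum_(i < k) a i.+1 * t ^+ i / i`!%:R).
Proof.
elim: k => [|k IH].
  rewrite big_ord0 (_ : (fun _ => _) = cst (a 0%N)); first exact: is_derive_cst.
  by apply/funext => s; rewrite big_ord1 expr0 mulr1 divr1.
rewrite (_ : (fun _ => _) = (fun t => \sum_(i < k.+1) a i * t ^+ i / i`!%:R) +
    (a k.+1 / (k.+1)`!%:R) *: (@id R) ^+ k.+1); last first.
  apply/funext => s; rewrite big_ord_recr/= !fctE; congr (_ + _).
  by rewrite /GRing.scale/= mulrAC.
apply: is_derive_eq; rewrite big_ord_recr/=; congr (_ + _).
rewrite scaler1 factS natrM /GRing.scale/=.
by field; exact: field_side.
Qed.

(** Induction on [k]: the derivative of the remainder at order [k.+1] is the remainder at order [k]
    of the shifted family [fun i => phi i.+1]. *)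
Lemma taylor_lipschitz (phi : nat -> R -> R) (k : nat) C t :
  (forall i (s : R), (i < k)%N -> is_derive s 1 (phi i) (phi i.+1 s)) ->
  (forall s, 0 <= s <= t -> `|phi k s - phi k 0| <= C * s) -> 0 <= t ->
  `|phi 0%N t - \sum_(i < k.+1) phi i 0 * t ^+ i / i`!%:R|
    <= C * t ^+ k.+1 / (k.+1)`!%:R.
Proof.
elim: k phi t => [|k IH] phi t dphi phiC t0.
  by rewrite big_ord1 expr0 mulr1 expr1 !divr1 phiC// t0 lexx.
pose g t := phi 0%N t - \sum_(i < k.+2) phi i 0 * t ^+ i / i`!%:R.
apply: (@norm_le_of_derive_le g
    (fun t => phi 1%N t - \sum_(i < k.+1) phi i.+1 0 * t ^+ i / i`!%:R)) => //.
- move=> s; apply: (@is_deriveB _ _ _ (phi 0%N)); first exact: dphi.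
  exact: (is_derive_taylor_sum (fun i => phi i 0) k.+1 s).
- rewrite /g big_ord_recl/= big1 => [|i _]; last by rewrite expr0n/= mulr0 mul0r.
  by rewrite expr0 mulr1 divr1 addr0 subrr.
move=> s /andP[s0 st]; apply: (IH (fun i => phi i.+1)) => //.
  by move=> i r ik; exact: dphi.
by move=> r /andP[r0 rs]; apply: phiC; rewrite r0 (le_trans rs).
Qed.

End RealTaylor.

(** * Multilinear functions on sequences of vectors *)

Section Multilinear.
Context {R : realType} {n : nat}.
Local Notation V := 'rV[R]_n.
Implicit Types (F G : seq V -> R) (s : seq V) (q : nat).

(** Arguments form a sequence rather than a tuple, so that cons, [nseq] and concatenation need no
    casts. *)
Fixpoint multilinear q F : Prop :=
  if q is q'.+1 then
    (forall s c a b, size s = q' ->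
       F (c *: a + b :: s) = c * F (a :: s) + F (b :: s)) /\
    forall a, multilinear q' (fun s => F (a :: s))
  else True.

Lemma eq_multilinear q F G : (forall s, size s = q -> F s = G s) ->
  multilinear q F -> multilinear q G.
Proof.
elim: q F G => [//|q IH] F G FG [Fl Fm]; split => [s c a b sq|a].
  by rewrite -!FG ?Fl//= sq.
by apply: IH (Fm a) => s sq; rewrite FG//= sq.
Qed.

Lemma multilinearB q F G : multilinear q F -> multilinear q G ->
  multilinear q (fun s => F s - G s).
Proof.
elim: q F G => [//|q IH] F G [Fl Fm] [Gl Gm]; split => [s c a b sq|a].
  by rewrite Fl// Gl//; ring.
exact: (IH (fun s => F (a :: s)) (fun s => G (a :: s)) (Fm a) (Gm a)).
Qed.

Lemma multilinearZ q F c : multilinear q F -> multilinear q (fun s => c * F s).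
Proof.
elim: q F => [//|q IH] F [Fl Fm]; split => [s c' a b sq|a].
  by rewrite Fl//; ring.
exact: (IH (fun s => F (a :: s)) (Fm a)).
Qed.

Lemma multilinear_sum (I : Type) (r : seq I) q (F : I -> seq V -> R) :
  (forall i, multilinear q (F i)) -> multilinear q (fun s => \sum_(i <- r) F i s).
Proof.
elim: q F => [//|q IH] F Fm; split => [s c a b sq|a].
  by rewrite mulr_sumr -big_split/=; apply: eq_bigr => i _; rewrite (proj1 (Fm i)).
by apply: (IH (fun i s => F i (a :: s))) => i; exact: (proj2 (Fm i)).
Qed.

Lemma multilinear_head0 q F s : multilinear q.+1 F -> size s = q -> F (0 :: s) = 0.
Proof.
move=> [Fl _] sq; have := Fl s 1 0 0 sq.
by rewrite scaler0 addr0 mul1r => /eqP; rewrite -subr_eq0 opprD addNKr oppr_eq0 => /eqP.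
Qed.

Lemma multilinear_headZ q F s c a : multilinear q.+1 F -> size s = q ->
  F (c *: a :: s) = c * F (a :: s).
Proof.
move=> Fm sq; have [Fl _] := Fm.
by have := Fl s c a 0 sq; rewrite addr0 (multilinear_head0 Fm sq) addr0.
Qed.

Lemma multilinear_head_sum q F s a : multilinear q.+1 F -> size s = q ->
  F (a :: s) = \sum_i a 0 i * F (basis_vec i :: s).
Proof.
move=> Fm sq; have [Fl _] := Fm; rewrite [in LHS](row_sum_delta a).
elim/big_ind2: _ => [|u x v y ux vy|i _].
- exact: multilinear_head0 Fm sq.
- by rewrite -(scale1r x) Fl// mul1r ux vy.
- by rewrite (multilinear_headZ _ _ Fm sq).
Qed.

(** Expanding the first argument in the canonical basis leaves [n] forms in one argument less.
    Boundedness makes the supremum in [opnorm] a genuine one. *)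
Lemma multilinear_bounded q F : multilinear q F ->
  exists B, forall s, size s = q -> {in s, forall a, enorm a <= 1} -> `|F s| <= B.
Proof.
elim: q F => [|q IH] F Fm.
  by exists `|F [::]| => s /size0nil ->.
have /= Fi (i : 'I_n) := IH _ (proj2 Fm (basis_vec i)).
pose B i := sval (cid (Fi i)).
exists (\sum_i B i) => -[//|a s] [sq] s1.
rewrite (multilinear_head_sum _ Fm sq).
apply: le_trans (ler_norm_sum _ _ _) (ler_sum _ _) => i _.
have FB : `|F (basis_vec i :: s)| <= B i.
  apply: (svalP (cid (Fi i))) => // b bs; apply: s1.
  by rewrite inE bs orbT.
rewrite normrM -[leRHS]mul1r ler_pM//.
by apply: le_trans (coord_le_enorm a i) _; apply: s1; rewrite inE eqxx.
Qed.

Lemma multilinear_le_prod q F K : multilinear q F ->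
  (forall s, size s = q -> {in s, forall a, enorm a <= 1} -> `|F s| <= K) ->
  forall s, size s = q -> `|F s| <= K * \prod_(a <- s) enorm a.
Proof.
elim: q F => [|q IH] F Fm FK.
  by move=> s /size0nil ->; rewrite big_nil mulr1 FK.
move=> [//|a s] [sq]; rewrite big_cons.
have [/enorm_eq0 ->|a0] := eqVneq (enorm a) 0.
  by rewrite (multilinear_head0 Fm sq) normr0 enorm0 mul0r mulr0.
pose b := (enorm a)^-1 *: a.
have b1 : enorm b = 1.
  by rewrite enormZ ger0_norm ?invr_ge0 ?enorm_ge0// mulVf.
have -> : a = enorm a *: b by rewrite scalerA divff// scale1r.
rewrite (multilinear_headZ _ _ Fm sq) normrM enormZ b1 mulr1.
rewrite (ger0_norm (enorm_ge0 a)) mulrCA ler_wpM2l ?enorm_ge0//.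
apply: (IH (fun s => F (b :: s))) => //; first exact: (proj2 Fm).
move=> s' sq' s1; apply: FK => /=; first by rewrite sq'.
by move=> c; rewrite inE => /orP[/eqP ->|/s1//]; rewrite b1.
Qed.

Lemma le_opnorm q (T : q.-tuple V -> R) F : multilinear q F ->
  (forall h : q.-tuple V, T h = F h) ->
  forall s, size s = q -> `|F s| <= opnorm T * \prod_(a <- s) enorm a.
Proof.
move=> Fm TF; apply: multilinear_le_prod => // s sq s1.
have [B FB] := multilinear_bounded Fm.
pose t : q.-tuple V := Tuple (introT eqP sq).
have -> : F s = T t by rewrite TF.
apply: ub_le_sup.
  exists B => _ [h h1 <-]; rewrite TF; apply: FB; first exact: size_tuple.
  by move=> a /tnthP[i ->]; exact: h1.
by exists t => // i; apply: s1; exact: (mem_tnth i t).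
Qed.

(** A supremum that exists dominates an absolute value; otherwise [sup] takes its default value
    0. *)
Lemma opnorm_ge0 q (T : q.-tuple V -> R) : 0 <= opnorm T.
Proof.
rewrite /opnorm; have [hs|/sup_out ->//] := pselect (has_sup [set `|T h| | h in
  [set h : q.-tuple V | forall i, enorm (tnth h i) <= 1]]).
have [[y [h h1 hy]] _] := hs.
by apply: le_trans (ub_le_sup (proj2 hs) (_ : _ `|T h|)) => //; exists h.
Qed.

(** The derivative of the diagonal of [F] at [v] in direction [u]: the product rule puts [u] into
    each slot in turn. The slots are kept apart because the finite-difference form is in general not
    symmetric. *)
Definition diag_deriv q F (v u : V) : R :=
  \sum_(i < q) F (nseq i v ++ u :: nseq (q - i.+1) v).

Lemma diag_deriv_le q F K v u :
  (forall s, size s = q -> `|F s| <= K * \prod_(a <- s) enorm a) ->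
  `|diag_deriv q F v u| <= q%:R * K * enorm v ^+ q.-1 * enorm u.
Proof.
move=> FK; apply: le_trans (ler_norm_sum _ _ _) _.
apply: le_trans (ler_sum _ (_ : forall i, _ -> _ <= K * enorm v ^+ q.-1 * enorm u)) _.
  move=> i _; have iq := ltn_ord i.
  apply: le_trans (FK _ _) _.
    by rewrite size_cat/= !size_nseq addnS -addSn subnKC.
  rewrite big_cat big_cons/= !big_nseq !iter_mulr_1.
  rewrite (_ : q.-1 = (i + (q - i.+1))%N); last first.
    by rewrite -{1}(subnKC iq) addSn.
  by rewrite exprD le_eqVlt; apply/orP; left; apply/eqP; ring.
by rewrite sumr_const card_ord -!mulrA mulr_natl.
Qed.

Lemma is_diff_coord (x : V) (i : 'I_n) :
  is_diff x (fun y : V => y 0 i : R) (fun u : V => u 0 i).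
Proof.
have lin : linear (fun y : V => y 0 i : R) by move=> c a b; rewrite !mxE.
pose lM := GRing.isLinear.Build _ _ _ _ _ lin.
pose l : {linear V -> R} := HB.pack (fun y : V => y 0 i : R) lM.
have lc : continuous l by exact: coord_continuous.
apply: DiffDef; first exact: differentiable_coord.
exact: (diff_lin x lc).
Qed.

Lemma is_diff_sum (I : Type) (r : seq I) (f df : I -> V -> R) (x : V) :
  (forall i, is_diff x (f i) (df i)) ->
  is_diff x (fun y => \sum_(i <- r) f i y) (fun u => \sum_(i <- r) df i u).
Proof.
move=> fdf; elim: r => [|i r IH].
  rewrite (_ : (fun _ => _) = cst 0); last by apply/funext => y; rewrite big_nil.
  rewrite (_ : (fun _ => _) = 0); last by apply/funext => y; rewrite big_nil.
  exact: is_diff_cst.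
rewrite (_ : (fun _ => _) = f i + (fun y => \sum_(i <- r) f i y)); last first.
  by apply/funext => y; rewrite big_cons.
have H := is_diffD (fdf i) IH; apply: is_diff_eq.
by apply/funext => y; rewrite big_cons.
Qed.

(** Induction on [q]: expanding the first slot in the canonical basis gives a sum of products of a
    coordinate with a diagonal of one degree less. *)
Lemma is_diff_diag q F (x y : V) : multilinear q F ->
  is_diff y (fun y => F (nseq q (y - x))) (diag_deriv q F (y - x)).
Proof.
elim: q F => [|q IH] F Fm.
  rewrite (_ : diag_deriv _ _ _ = 0).
    exact: (is_diff_cst (F [::]) y).
  by apply/funext => u; rewrite /diag_deriv big_ord0.
have Fi i := IH _ (proj2 Fm (basis_vec i)).
rewrite (_ : (fun _ => _) = (fun y => \sum_i
   (fun y => (y - x) 0 i) y * F (basis_vec i :: nseq q (y - x)))); last first.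
  by apply/funext => z; rewrite /= (multilinear_head_sum _ Fm)// size_nseq.
rewrite (_ : diag_deriv _ _ _ = (fun u => \sum_i
   ((y - x) 0 i * diag_deriv q (fun s => F (basis_vec i :: s)) (y - x) u +
    F (basis_vec i :: nseq q (y - x)) * u 0 i))); last first.
  apply/funext => u; rewrite /diag_deriv big_ord_recl/= subn1/=.
  rewrite (multilinear_head_sum _ Fm) ?size_nseq// addrC.
  rewrite big_split/=; congr (_ + _); last by apply: eq_bigr => i _; rewrite mulrC.
  under [RHS]eq_bigr do rewrite mulr_sumr.
  rewrite exchange_big/=; apply: eq_bigr => j _.
  rewrite (multilinear_head_sum _ Fm)// size_cat/= !size_nseq subSS.
  by rewrite /bump leq0n add0n add1n addnS -addSn subnKC.
apply: (@is_diff_sum _ _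
  (fun i y => (y - x) 0 i * F (basis_vec i :: nseq q (y - x)))
  (fun i u => (y - x) 0 i * diag_deriv q (fun s => F (basis_vec i :: s)) (y - x) u +
    F (basis_vec i :: nseq q (y - x)) * u 0 i)) => i.
pose g (y : V) : R := (y - x) 0 i.
have dg : is_diff y g (fun u => u 0 i).
  rewrite (_ : g = (fun y : V => y 0 i : R) - cst (x 0 i)); last first.
    by apply/funext => z; rewrite /g !mxE.
  by apply: is_diff_eq; [apply: is_diffB; exact: is_diff_coord|rewrite subr0].
exact: (is_diffM dg (Fi i)).
Qed.

End Multilinear.

(** * Iterated directional derivatives *)

Section LineDerivative.
Context {R : realType} {n : nat}.
Local Notation V := 'rV[R]_n.
Implicit Types (f g : V -> R) (x u v a b : V) (s : seq V).

Lemma is_derive_line g x v (t : R) : differentiable g (x + t *: v) ->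
  is_derive t 1 (fun t : R => g (x + t *: v)) ('d g (x + t *: v) v).
Proof.
move=> /differentiableP dg.
have dl : is_diff t (cst x + ( *:%R ^~ v)) (0 + ( *:%R ^~ v)) by exact: is_diffD.
have dc := is_diff_comp dl dg.
have fE : (fun t : R => g (x + t *: v)) = g \o (cst x + ( *:%R ^~ v)) by [].
apply: DeriveDef; rewrite fE; first exact/diff_derivable.
by rewrite deriveE// diff_val/= !fctE add0r scale1r.
Qed.

Let linear_comb (l : {linear V -> R}) t b r a :
  l (t *: b + r *: a) = t * l b + r * l a.
Proof. by rewrite linearD !linearZ. Qed.

Lemma differentiable_remainder g x : differentiable g x -> exists dd : V -> R,
  [/\ forall h, dd h = 'd g x h,
      forall t b r a, dd (t *: b + r *: a) = t * dd b + r * dd a &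
      forall e : R, 0 < e -> exists2 d : R, 0 < d &
        forall h : V, `|h| < d -> `|g (x + h) - g x - dd h| <= e * `|h| ].
Proof.
move=> /diff_locally/eqaddoP dg; exists ('d g x); split => [//|t b r a|e e0].
  exact: linear_comb.
have /nbhs_ballP[d d0 dP] := dg e e0.
exists d => // h hd; have /dP : ball (0 : V) d h by rewrite -ball_normE/= sub0r normrN.
by rewrite /= !fctE opprD addrA (addrC x).
Qed.

(* The second difference is computed by the mean value theorem in the direction
   [a] and expanded to first order in the direction [b]; this needs no continuity
   of the second derivatives. *)
Lemma second_difference g (ga : V -> R) x a b (D : R) : (forall y, differentiable g y) ->
  (forall y, 'd g y a = ga y) -> differentiable ga x -> 'd ga x b = D -> forall e : R, 0 < e ->
  exists2 d : R, 0 < d & forall t : R, 0 < t < d ->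
    `|g (x + t *: b + t *: a) - g (x + t *: b) - g (x + t *: a) + g x
      - t ^+ 2 * D| <= e * t ^+ 2.
Proof.
move=> dg dga da daD e e0.
(* The norms of the increments [r *: a] and [t *: b + r *: a] add up to at most [t * c]; the summand
   1 keeps [c] positive. *)
pose c : R := `|b| + 2 * `|a| + 1.
have c0 : 0 < c by rewrite ltr_pwDr// addr_ge0// mulr_ge0.
have [dd [ddE ddl /(_ _ (divr_gt0 e0 c0)) [d d0 dP]]] := differentiable_remainder da.
rewrite -daD -(ddE b).
exists (d / c); first exact: divr_gt0.
move=> t /andP[t0 td]; have t0' := ltW t0.
pose phi (r : R) := g ((x + t *: b) + r *: a) - g (x + r *: a).
have dphi (r : R) : is_derive r 1 phi
    (ga ((x + t *: b) + r *: a) - ga (x + r *: a)).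
  by rewrite -!dga; apply: is_deriveB; exact: is_derive_line.
have cphi : {within `[0, t], continuous phi}.
  by apply: derivable_within_continuous => r _; exact: ex_derive.
have [r] := MVT_segment t0' (fun r _ => dphi r) cphi.
rewrite in_itv/= => /andP[r0 rt]; rewrite /phi !scale0r !addr0 subr0 => phiE.
rewrite (_ : _ + g x = g (x + t *: b + t *: a) - g (x + t *: a)
   - (g (x + t *: b) - g x)); last by ring.
rewrite {}phiE -addrA.
have tdc : t * c < d by rewrite -ltr_pdivlMr.
have na : `|r *: a| <= t * `|a| by rewrite normrZ ger0_norm// ler_wpM2r.
have nba : `|t *: b + r *: a| <= t * (`|b| + `|a|).
  rewrite mulrDr (le_trans (ler_normD _ _))// lerD// normrZ ger0_norm//.
have tb0 : 0 <= t * `|b| by rewrite mulr_ge0.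
have ta0 : 0 <= t * `|a| by rewrite mulr_ge0.
have rest : t * c = t * `|b| + 2 * (t * `|a|) + t by rewrite /c; ring.
have := dP (t *: b + r *: a); have := dP (r *: a).
have := ddl 0 b r a; rewrite scale0r mul0r !add0r => ->; rewrite ddl => A1 A2.
have {}A1 := A1 ltac:(lra); have {}A2 := A2 ltac:(lra).
move: A1 A2; set A := ga (x + r *: a); set B := ga (x + (_ + _)); set C := ga x.
move=> A1 A2.
rewrite (_ : _ - _ = ((B - C - (t * dd b + r * dd a)) - (A - C - r * dd a)) * t).
  rewrite normrM (ger0_norm t0') expr2 mulrA ler_wpM2r//.
  apply: le_trans (ler_normB _ _) _; apply: le_trans (lerD A2 A1) _.
  rewrite -mulrDr -mulrA ler_wpM2l ?(ltW e0)// ler_pdivrMl// mulrC rest.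
  lra.
ring.
Qed.

(** The second difference is symmetric in [a] and [b], and up to o(t^2) it equals [t ^+ 2] times
    either mixed derivative. *)
Lemma schwarz g x a b : (forall y, differentiable g y) ->
  differentiable (fun y => 'd g y a) x -> differentiable (fun y => 'd g y b) x ->
  'd (fun y => 'd g y a) x b = 'd (fun y => 'd g y b) x a.
Proof.
move=> dg da db.
have [X XE] : exists X, 'd (fun y => 'd g y a) x b = X by eexists.
have [Y YE] : exists Y, 'd (fun y => 'd g y b) x a = Y by eexists.
suff XY : X = Y by exact: etrans XE (etrans XY (esym YE)).
have H1 := second_difference dg (fun=> erefl) da XE.
have H2 := second_difference dg (fun=> erefl) db YE.
move=> {XE YE da db}.
apply/eqP; rewrite -subr_eq0 -normr_le0; apply/ler_addgt0Pr => e e0.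
rewrite add0r; have e2 : 0 < e / 2 by rewrite divr_gt0.
have {H1}[d1 d10 H1] := H1 _ e2; have {H2}[d2 d20 H2] := H2 _ e2.
pose t := Num.min d1 d2 / 2.
have t0 : 0 < t by rewrite divr_gt0// lt_min d10 d20.
have tm : t < Num.min d1 d2 by rewrite ltr_pdivrMr// ltr_pMr ?ltr1n// lt_min d10 d20.
move: tm; rewrite lt_min => /andP[t1 t2].
have := H1 t; rewrite t0 t1 => /(_ isT) A1.
have := H2 t; rewrite t0 t2 => /(_ isT) A2.
rewrite -(ler_pM2r (exprn_gt0 2 t0)).
rewrite -[X in _ * X]ger0_norm ?sqr_ge0// -normrM.
move: A1 A2; rewrite (addrAC x (t *: a)).
set A := g _; set B := g _; set C := g _; set D := g x => A1 A2.
rewrite (_ : _ * _ = (A - C - B + D - t ^+ 2 * Y) - (A - B - C + D - t ^+ 2 * X)); last by ring.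
by apply: le_trans (ler_normB _ _) _; apply: le_trans (lerD A2 A1) _; lra.
Qed.

(** The values of [nabla] with the directions in a sequence, whose head is the direction
    differentiated last. *)
Definition dir_deriv f s : V -> R := foldr (fun a g x => 'd g x a) f s.

Lemma nabla_dir_deriv q f x (h : q.-tuple V) : nabla q f x h = dir_deriv f h x.
Proof.
elim: q x h => [|q IH] x h; first by rewrite tuple0.
case/tupleP: h => a h /=; rewrite theadE.
have -> // : (fun y => nabla q f y [tuple of behead [tuple of a :: h]]) = dir_deriv f h.
by apply/funext => y; rewrite IH.
Qed.

Lemma times_differentiable_dir_deriv p f : times_differentiable p f ->
  forall s, (size s < p)%N -> forall x, differentiable (dir_deriv f s) x.
Proof.
move=> df s sp x; have := df _ sp (in_tuple s) x.
have -> // : (fun y => nabla (size s) f y (in_tuple s)) = dir_deriv f s.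
by apply/funext => y; rewrite nabla_dir_deriv.
Qed.

Lemma multilinear_diff q (G : seq V -> V -> R) x a :
  (forall y, multilinear q (fun s => G s y)) ->
  (forall s, size s = q -> differentiable (G s) x) ->
  multilinear q (fun s => 'd (G s) x a).
Proof.
elim: q G => [//|q IH] G Gm Gd; split => [s c b1 b2 sq|b].
  have d1 : differentiable (G (b1 :: s)) x by apply: Gd; rewrite /= sq.
  have d2 : differentiable (G (b2 :: s)) x by apply: Gd; rewrite /= sq.
  have -> : G (c *: b1 + b2 :: s) = c *: G (b1 :: s) + G (b2 :: s).
    by apply/funext => y; rewrite (proj1 (Gm y)).
  apply: etrans (congr1 (@^~ a) (diffD (differentiableZ c d1) d2)) _.
  by congr (_ + _); exact: (congr1 (fun h => h a) (@diffZ _ _ _ _ c _ d1)).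
by apply: IH => [y|s sq]; [exact: (proj2 (Gm y) b)|apply: Gd; rewrite /= sq].
Qed.

(** * Symmetry of higher derivatives and Taylor expansion along a segment *)

Section Smooth.
Context (p : nat) (f : V -> R).
Hypothesis df : forall s, (size s < p)%N -> forall x, differentiable (dir_deriv f s) x.

Lemma dir_deriv_multilinear q x : (q <= p)%N -> multilinear q (fun s => dir_deriv f s x).
Proof.
elim: q x => [//|q IH] x qp; split => [s c a b sq|a] /=.
  by rewrite linearP.
apply: multilinear_diff => [y|s sq]; first by apply: IH; exact: ltnW.
by apply: df; rewrite sq.
Qed.

(** Symmetry reaches the top order [p], because [schwarz] works with first derivatives that are
    merely differentiable at the point. *)
Lemma dir_deriv_swap a b s x : ((size s).+1 < p)%N ->
  dir_deriv f (a :: b :: s) x = dir_deriv f (b :: a :: s) x.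
Proof.
move=> sp; apply: schwarz => [y||]; first by apply: df; exact: ltnW.
- exact: (df (s := b :: s)).
- exact: (df (s := a :: s)).
Qed.

(** In last place [u] is differentiated first, so these values become derivatives along [v] of
    [dir_deriv f [:: u]]. This links the gradient of the model to a Taylor polynomial of the
    gradient of [f]. *)
Lemma dir_deriv_move v u i j x : (i + j < p)%N ->
  dir_deriv f (nseq i v ++ u :: nseq j v) x = dir_deriv f (nseq (i + j) v ++ [:: u]) x.
Proof.
elim: i x => [|i IH] x ijp; last first.
  by congr ('d _ x v); apply/funext => y; exact: IH (ltnW ijp).
elim: j x ijp => [//|j IH] x ijp; rewrite add0n.
have sz : ((size (nseq j v)).+1 < p)%N by rewrite size_nseq.
apply: etrans (dir_deriv_swap _ _ _ sz) _.
by congr ('d _ x v); apply/funext => y; exact: IH (ltnW ijp).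
Qed.

Lemma diag_deriv_dir_deriv q v u x : (q < p)%N ->
  diag_deriv q.+1 (fun s => dir_deriv f s x) v u =
  q.+1%:R * dir_deriv f (nseq q v ++ [:: u]) x.
Proof.
move=> qp; rewrite /diag_deriv (eq_bigr (fun=> dir_deriv f (nseq q v ++ [:: u]) x)).
  by rewrite sumr_const card_ord mulr_natl.
move=> i _; have iq : (i <= q)%N by rewrite -ltnS.
by rewrite subSS dir_deriv_move subnKC.
Qed.

Context (L : R).
Hypothesis lip : forall s x y, size s = p ->
  `|dir_deriv f s x - dir_deriv f s y| <= L * enorm (x - y) * \prod_(a <- s) enorm a.

(** [taylor_lipschitz] on the segment from [x] to [x + v]. It is used with [s] empty for the values
    of [f], with one vector for the gradient, and with [k = 1] for finite differences. *)
Lemma taylor_dir_deriv k s x v : (k + size s)%N = p ->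
  `|dir_deriv f s (x + v) - \sum_(i < k.+1) dir_deriv f (nseq i v ++ s) x / i`!%:R|
    <= L * enorm v ^+ k.+1 * \prod_(a <- s) enorm a / (k.+1)`!%:R.
Proof.
move=> ksp.
have := @taylor_lipschitz R (fun i (t : R) => dir_deriv f (nseq i v ++ s) (x + t *: v))
  k (L * enorm v ^+ k.+1 * \prod_(a <- s) enorm a) 1 _ _ ler01.
rewrite /= scale1r expr1n mulr1 scale0r addr0.
under [X in _ - X]eq_bigr do rewrite expr1n mulr1.
apply=> [i t ik|t /andP[t0 t1]].
  by apply: is_derive_line; apply: df; rewrite size_cat size_nseq -ksp ltn_add2r.
apply: le_trans (lip _ _ _) _; first by rewrite size_cat size_nseq.
rewrite addrAC subrr add0r enormZ ger0_norm//.
rewrite big_cat/= big_nseq iter_mulr_1 le_eqVlt; apply/orP; left; apply/eqP.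
by rewrite exprS; ring.
Qed.

End Smooth.
End LineDerivative.

(** * Derivative of the regularization term *)

Section NormPower.
Context {R : realType} {n : nat}.
Local Notation V := 'rV[R]_n.
Implicit Types (x y u : V).

Lemma is_diff_dot x y :
  is_diff y (fun y => dot (y - x) (y - x)) (fun u => 2 * dot (y - x) u).
Proof.
pose F (s : seq V) := dot (nth 0 s 0) (nth 0 s 1).
have Fm : multilinear 2 F.
  split=> [s c a b _|a]; first by rewrite /F /= dotDl dotZl.
  by split=> // s c b b' _; rewrite /F /= dotDr dotZr.
have dF := is_diff_diag x y Fm; apply: is_diff_eq.
apply/funext => u; rewrite /diag_deriv !big_ord_recr big_ord0/= add0r /F/=.
by rewrite (dotC u) mulr_natl mulr2n.
Qed.

Lemma is_diff_enorm x y : y != x ->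
  is_diff y (fun y => enorm (y - x)) (fun u => dot (y - x) u / enorm (y - x)).
Proof.
move=> yx; have e0 : 0 < enorm (y - x).
  rewrite lt0r enorm_ge0 andbT; apply: contra_neq yx => /enorm_eq0/eqP.
  by rewrite subr_eq0 => /eqP.
pose g y : R := dot (y - x) (y - x).
have g0 : 0 < g y by rewrite /g -sqr_enorm exprn_gt0.
have ds := is_derive1_sqrt g0.
have dsq : is_diff (g y) (@Num.sqrt R) (fun h => h * (2 * enorm (y - x))^-1).
  have dd : differentiable (@Num.sqrt R) (g y).
    by apply/derivable1_diffP; exact: ex_derive.
  apply: DiffDef => //; rewrite diff1E//; apply/funext => h.
  by rewrite derive1E derive_val.
have dc := is_diff_comp (is_diff_dot x y) dsq; apply: is_diff_eq.
by apply/funext => u /=; field; rewrite gt_eqF.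
Qed.

(** At the center the chain rule through the norm breaks down; a power of exponent at least 2 is
    O(|h|^2) there, which forces the differential to be 0. *)
Lemma diff_enorm_at_center x k :
  differentiable (fun y => enorm (y - x) ^+ k.+2) x /\
  'd (fun y => enorm (y - x) ^+ k.+2) x = (fun=> 0) :> (V -> R).
Proof.
pose f y : R := enorm (y - x) ^+ k.+2.
pose z : {linear V -> R} := \0%R.
have zc : continuous (z : V -> R) by move=> y; exact: cst_continuous.
have fE : f \o shift x = cst (f x) + z +o_ (0 : V) id.
  apply/eqaddoP => e e0; pose c : R := n%:R + 1.
  have c0 : 0 < c by rewrite ltr_wpDl.
  apply/nbhs_ballP; exists (Num.min (c^-1) (e / c)) => /=.
    by rewrite lt_min invr_gt0 c0 divr_gt0.
  move=> h; rewrite -ball_normE/= sub0r normrN lt_min => /andP[h1 h2].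
  rewrite !fctE /= /f subrr enorm0 expr0n/= addr0 subr0 addrK.
  have e2 : enorm h ^+ 2 <= c * `|h| ^+ 2.
    rewrite sqr_enorm (le_trans (dot_le_norm h))// ler_wpM2r ?sqr_ge0//.
    by rewrite lerDl.
  have hc : c * `|h| <= 1 by rewrite -ler_pdivlMl// mulr1 ltW.
  have e1 : enorm h <= 1.
    rewrite -(@expr_le1 _ 2)// ?enorm_ge0// (le_trans e2)//.
    have c1 : 1 <= c by rewrite lerDr.
    have hh : `|h| <= 1 by apply: le_trans hc; rewrite ler_peMl.
    by rewrite expr2 mulrA mulr_ile1// mulr_ge0// ltW.
  rewrite ger0_norm ?exprn_ge0 ?enorm_ge0// -addn2 exprD.
  apply: (@le_trans _ _ (1 * (c * `|h| ^+ 2))).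
    by rewrite ler_pM ?exprn_ge0 ?sqr_ge0 ?enorm_ge0// exprn_ile1// enorm_ge0.
  rewrite mul1r expr2 mulrA ler_wpM2r//.
  by rewrite -ler_pdivlMl// mulrC ltW.
have dz := diff_unique zc fE.
split; last by rewrite dz.
by apply/diff_locallyP; rewrite dz; split.
Qed.

Lemma diff_enorm_power x y k :
  differentiable (fun y => enorm (y - x) ^+ k.+2) y /\
  forall u, `|'d (fun y => enorm (y - x) ^+ k.+2) y u|
     <= k.+2%:R * enorm (y - x) ^+ k.+1 * enorm u.
Proof.
have [->|yx] := eqVneq y x.
  have [dx ->] := diff_enorm_at_center x k; split => // u.
  by rewrite normr0 !mulr_ge0 ?exprn_ge0 ?enorm_ge0.
have dX := is_diffX k.+1 (is_diff_enorm yx).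
have -> : (fun y => enorm (y - x) ^+ k.+2) = (fun y => enorm (y - x)) ^+ k.+2.
  by apply/funext => z; rewrite exprfctE.
split => [//|u]; rewrite diff_val /= fctE.
have e0 : 0 < enorm (y - x).
  rewrite lt0r enorm_ge0 andbT; apply: contra_neq yx => /enorm_eq0/eqP.
  by rewrite subr_eq0 => /eqP.
rewrite /GRing.scale/= normrM ger0_norm ?mulr_ge0 ?exprn_ge0 ?enorm_ge0//.
rewrite ler_wpM2l ?mulr_ge0 ?exprn_ge0 ?enorm_ge0//.
by rewrite normrM normfV (gtr0_norm e0) ler_pdivrMr// mulrC cauchy_schwarz.
Qed.

Lemma dot_grad (g : V -> R) x u : dot (grad g x) u = 'd g x u.
Proof.
have lin (l : {linear V -> R}) : l u = \sum_i l (basis_vec i) * u 0 i.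
  rewrite [in LHS](row_sum_delta u) linear_sum; apply: eq_bigr => i _.
  by rewrite linearZ mulrC.
by rewrite [RHS]lin; apply: eq_bigr => i _; rewrite mxE.
Qed.

Lemma enorm_grad_le (g : V -> R) x c : 0 <= c ->
  (forall u, 'd g x u <= c * enorm u) -> enorm (grad g x) <= c.
Proof.
move=> c0 gc; have [->//|gn0] := eqVneq (enorm (grad g x)) 0.
rewrite -(@ler_pM2r _ (enorm (grad g x))) ?lt0r ?gn0 ?enorm_ge0//.
by rewrite -expr2 sqr_enorm dot_grad.
Qed.

End NormPower.

(** * One tensor step *)

Section OneStep.
Context {R : realType} {n q : nat}.
Local Notation V := 'rV[R]_n.
Local Notation p := q.+1.
Context (f : V -> R) (L : R).
Hypothesis df : forall s, (size s < p)%N -> forall x, differentiable (dir_deriv f s) x.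
Hypothesis lip : forall s x y, size s = p ->
  `|dir_deriv f s x - dir_deriv f s y| <= L * enorm (x - y) * \prod_(a <- s) enorm a.

(** The differenced direction stands in first place, like the outermost direction of [dir_deriv]; in
    [fd_form] it stands last. Both agree on the diagonal, which is all that the model sees. *)
Definition fd_multi (h : R) (z : V) (s : seq V) : R :=
  \sum_i (head 0 s) 0 i *
    ((dir_deriv f (behead s) (z + h *: basis_vec i) - dir_deriv f (behead s) z) / h).

Lemma fd_multi_multilinear h z : multilinear p (fd_multi h z).
Proof.
have qp : (q <= p)%N by exact: leqnSn.
split => [s c a b sq|a].
  rewrite /fd_multi mulr_sumr -big_split/=; apply: eq_bigr => i _.
  by rewrite !mxE; ring.
rewrite /fd_multi/=; apply: multilinear_sum => i; apply: multilinearZ.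
apply: (eq_multilinear (F := fun s => h^-1 *
    (dir_deriv f s (z + h *: basis_vec i) - dir_deriv f s z))).
  by move=> s _; rewrite mulrC.
by apply/multilinearZ/multilinearB; exact: (dir_deriv_multilinear df _ qp).
Qed.

Lemma fd_form_diag h z v :
  diag_eval (fd_form f h z : p.-tuple V -> R) v = fd_multi h z (nseq p v).
Proof.
have nv j : (j < p)%N -> [tuple of nseq p v]`_j = v.
  by move=> jp; rewrite -[X in X`_j]/(nseq p v) nth_nseq jp.
rewrite /diag_eval /fd_form /fd_multi; apply: eq_bigr => i _.
rewrite /form_tensor mulrC nv// dotC dot_basis; congr (_ * _).
rewrite !nabla_dir_deriv.
have -> : tval [tuple [tuple of nseq p v]`_i0 | i0 < p.-1] = nseq q v => //.
apply: (@eq_from_nth _ 0) => [|j]; first by rewrite size_tuple size_nseq.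
rewrite size_tuple => jq.
rewrite nth_nseq jq -[j]/(val (Ordinal jq)) -tnth_nth tnth_mktuple nv//.
exact: ltnW.
Qed.

(** By Taylor at order 1, each difference quotient is off by at most [L * h / 2] times the norms of
    the other arguments; [sum_coord_le_enorm] sums over the basis vectors. *)
Lemma fd_multi_error h z s : 0 < h -> size s = p -> 0 <= L ->
  `|fd_multi h z s - dir_deriv f s z|
    <= L * (Num.sqrt n%:R * h / 2) * \prod_(a <- s) enorm a.
Proof.
move=> h0; case: s => // a s [sq] L0.
have Dm := dir_deriv_multilinear df z (leqnn p).
rewrite [X in _ - X](multilinear_head_sum _ Dm)//.
rewrite /fd_multi -sumrB /=; apply: le_trans (ler_norm_sum _ _ _) _.
rewrite big_cons.
pose P := \prod_(a <- s) enorm a.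
apply: le_trans (ler_sum _ (_ : forall i, _ -> _ <= `|a 0 i| * (L * h / 2 * P))) _.
  move=> i _; rewrite -mulrBr normrM ler_wpM2l//.
  have := taylor_dir_deriv df lip (k := 1) (s := s) z (h *: basis_vec i).
  rewrite add1n sq => /(_ erefl).
  rewrite !big_ord_recl big_ord0 /= addr0 !divr1 enormZ enorm_basis mulr1.
  rewrite (gtr0_norm h0) opprD addrA.
  have Dh : 'd (dir_deriv f s) z (h *: basis_vec i) =
     h * 'd (dir_deriv f s) z (basis_vec i) by exact: linearZ.
  rewrite [X in `|_ - X|]Dh => Dle.
  rewrite -(@ler_pM2r _ h)// -[X in _ * X <= _](gtr0_norm h0) -normrM mulrBl divfK ?gt_eqF//.
  rewrite (mulrC _ h); apply: le_trans Dle _.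
  rewrite -/P (_ : 1.+1`! = 2)//.
  by rewrite le_eqVlt; apply/orP; left; apply/eqP; field.
rewrite -mulr_suml -/P.
have P0 : 0 <= P by apply: prodr_ge0 => b _; exact: enorm_ge0.
apply: le_trans (ler_wpM2r _ (sum_coord_le_enorm a)) _.
  by rewrite !mulr_ge0// ltW// invr_gt0.
by rewrite le_eqVlt; apply/orP; left; apply/eqP; ring.
Qed.

(* The multilinear form [G] stands for the approximation of the top derivative;
   on the diagonal it agrees with the form [T] of the model. *)
Context (T : p.-tuple V -> R) (G : seq V -> R) (sigma K : R) (x : V).
Hypotheses (Gm : multilinear p G)
  (TG : forall v, diag_eval T v = G (nseq p v))
  (GK : forall s, size s = p ->
    `|G s - dir_deriv f s x| <= K * \prod_(a <- s) enorm a)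
  (L0 : 0 <= L) (K0 : 0 <= K) (sigma0 : 0 < sigma).

Let H (s : seq V) := G s - dir_deriv f s x.

Let Hm : multilinear p H.
Proof. by apply: multilinearB => //; exact: (dir_deriv_multilinear df x (leqnn p)). Qed.

Let taylor (y : V) := \sum_(i < p.+1) dir_deriv f (nseq i (y - x)) x / i`!%:R.

Lemma modelE y : model f T sigma x y = taylor y + H (nseq p (y - x)) / p`!%:R
  + sigma / (p.+1)`!%:R * enorm (y - x) ^+ p.+1.
Proof.
rewrite /model; congr (_ + _); rewrite TG /taylor /H big_ord_recr/= mulrBl.
rewrite -[RHS]addrA [X in _ = _ + X]addrC subrK mulrC; congr (_ + _).
rewrite big_ord_recl/= divr1 big_add1/= big_mkord; congr (_ + _).
apply: eq_bigr => i _.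
have E := nabla_dir_deriv f x [tuple of nseq i.+1 (y - x)].
exact: etrans (mulrC _ _) (congr1 (fun r => r / (i.+1)`!%:R) E).
Qed.

(** The factor [i.+1] from [diag_deriv_dir_deriv] cancels against the factorial, leaving the Taylor
    polynomial, one order lower, of [dir_deriv f [:: u]]. *)
Lemma is_diff_taylor y : is_diff y taylor
  (fun u => \sum_(i < p) dir_deriv f (nseq i (y - x) ++ [:: u]) x / i`!%:R).
Proof.
have di (i : 'I_p.+1) := is_diffZ (i`!%:R^-1)
   (is_diff_diag x y (dir_deriv_multilinear df x (ltn_ord i : (i <= p)%N))).
have := is_diff_sum (index_enum _) di.
rewrite (_ : (fun y => \sum_(i < p.+1) _) = taylor); last first.
  by apply/funext => w; apply: eq_bigr => i _; rewrite mulrC.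
move=> dt; apply: is_diff_eq; apply/funext => u.
rewrite big_ord_recl [X in X + _](_ : _ = 0) ?add0r; last first.
  by rewrite fctE /diag_deriv big_ord0 scaler0.
apply: eq_bigr => i _; rewrite fctE.
rewrite -[X in _ *: X]/(diag_deriv i.+1 _ _ u) (diag_deriv_dir_deriv df)//.
rewrite /GRing.scale/= factS natrM; field.
by rewrite addrC natr1 !pnatr_eq0 -lt0n fact_gt0.
Qed.

Lemma diff_model y u : differentiable (model f T sigma x) y /\
  'd (model f T sigma x) y u =
    \sum_(i < p) dir_deriv f (nseq i (y - x) ++ [:: u]) x / i`!%:R
    + diag_deriv p H (y - x) u / p`!%:R
    + sigma / (p.+1)`!%:R * 'd (fun y => enorm (y - x) ^+ p.+1) y u.
Proof.
have [/differentiableP dn _] := diff_enorm_power x y q.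
have dm := is_diffD (is_diffD (is_diff_taylor y)
  (is_diffZ (p`!%:R^-1) (is_diff_diag x y Hm))) (is_diffZ (sigma / (p.+1)`!%:R) dn).
have ME : model f T sigma x = taylor + p`!%:R^-1 *: (fun y => H (nseq p (y - x)))
    + (sigma / (p.+1)`!%:R) *: (fun y => enorm (y - x) ^+ p.+1).
  by apply/funext => w; rewrite modelE !fctE /GRing.scale/= [X in _ + X + _]mulrC.
rewrite -ME in dm; split; first exact: ex_diff.
rewrite diff_val !fctE; congr (_ + _ + _).
by rewrite /GRing.scale/= mulrC.
Qed.

Lemma tensor_step_value x' : tensor_step f T sigma x x' ->
  f x' <= f x + K * enorm (x' - x) ^+ p / p`!%:R
    - (sigma - L) * enorm (x' - x) ^+ p.+1 / (p.+1)`!%:R.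
Proof.
have xx' : x + (x' - x) = x' by rewrite addrC subrK.
move=> [Mle _]; have := taylor_dir_deriv df lip (k := p) (s := [::]) x (x' - x).
rewrite addn0 big_nil mulr1 xx' => /(_ erefl) /(le_trans (ler_norm _)).
under eq_bigr do rewrite cats0.
rewrite -/(taylor x') /= => tl.
have pf : 0 <= (p`!%:R)^-1 :> R by rewrite invr_ge0.
have Hge : - (K * enorm (x' - x) ^+ p / p`!%:R) <= H (nseq p (x' - x)) / p`!%:R.
  rewrite -mulNr ler_wpM2r//; have := GK (s := nseq p (x' - x)).
  rewrite size_nseq => /(_ erefl); rewrite big_nseq iter_mulr_1 => /ler_normlP[].
  by rewrite lerNl.
move: Mle; rewrite modelE; move: Hge tl.
set A := H _ / _; set B := K * _ / _; set X := L * _ / _; set Y := sigma / _ * _.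
rewrite (_ : (sigma - L) * _ / _ = Y - X); last by rewrite /Y /X; ring.
lra.
Qed.

(** The gradients of [f] and of the model differ by the Taylor remainder ([L]), the error form
    ([p * K]) and the regularization ([sigma]). The gradient test adds [sigma / 2], whence
    [3 / 2 * sigma]. *)
Lemma tensor_step_grad x' : tensor_step f T sigma x x' ->
  p`!%:R * enorm (grad f x') <= (L + 3 / 2 * sigma) * enorm (x' - x) ^+ p
    + p%:R * K * enorm (x' - x) ^+ q.
Proof.
have xx' : x + (x' - x) = x' by rewrite addrC subrK.
move=> [_ Mg]; have pf : 0 < p`!%:R :> R by rewrite ltr0n fact_gt0.
rewrite mulrC -ler_pdivlMr//; apply: enorm_grad_le => [|u].
  rewrite divr_ge0 ?addr_ge0 ?mulr_ge0 ?exprn_ge0 ?enorm_ge0 ?ler0n//.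
  by rewrite addr_ge0 ?mulr_ge0 ?divr_ge0// ltW.
have [_ Mu] := diff_model x' u.
have Mc : 'd (model f T sigma x) x' u <= sigma / (2 * p`!%:R) * enorm (x' - x) ^+ p * enorm u.
  rewrite -dot_grad; apply: le_trans (ler_norm _) (le_trans (cauchy_schwarz _ _) _).
  by rewrite ler_wpM2r ?enorm_ge0.
have := taylor_dir_deriv df lip (k := q) (s := [:: u]) x (x' - x).
rewrite addn1 big_seq1 xx' => /(_ erefl) /(le_trans (ler_norm _)).
have := @diag_deriv_le _ _ p H K (x' - x) u GK => /ler_normlP[Hl _].
have [_ /(_ u) /ler_normlP[Nl _]] := diff_enorm_power x x' q.
rewrite -[dir_deriv f [:: u] x']/('d f x' u) => Tl; rewrite {}Mu in Mc.
have fS : (p.+1)`!%:R = p.+1%:R * p`!%:R :> R by rewrite factS natrM.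
have p1 : 0 < p.+1%:R :> R by rewrite ltr0n.
have {}Hl : - (diag_deriv p H (x' - x) u / p`!%:R) <=
    p%:R * K * enorm (x' - x) ^+ q * enorm u / p`!%:R.
  by rewrite -mulNr ler_wpM2r// invr_ge0 ltW.
have s1 : 0 <= sigma / (p.+1)`!%:R by rewrite divr_ge0// ltW.
have {}Nl := ler_wpM2l s1 Nl; move: Nl Mc Hl Tl.
rewrite mulrN.
set A := \sum_(i < p) _; set B := diag_deriv _ _ _ _ / _; set C := sigma / _ * 'd _ _ _.
set Z := 'd f x' u.
rewrite (_ : sigma / (p.+1)`!%:R * _ = sigma * enorm (x' - x) ^+ p * enorm u / p`!%:R);
  last by rewrite fS; field; rewrite !gt_eqF.
rewrite (_ : sigma / (2 * p`!%:R) * _ * _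
   = sigma * enorm (x' - x) ^+ p * enorm u / p`!%:R / 2); last by field; rewrite gt_eqF.
rewrite (_ : (_ + p%:R * K * _) / _ * _ = L * enorm (x' - x) ^+ p * enorm u / p`!%:R
   + 3 / 2 * (sigma * enorm (x' - x) ^+ p * enorm u / p`!%:R)
   + p%:R * K * enorm (x' - x) ^+ q * enorm u / p`!%:R); last by ring.
lra.
Qed.
End OneStep.

(** * Summing the decrease along an inner run *)

Section DescentSum.
Context {R : realType}.
Implicit Types (a b : R) (r : nat -> R).

Lemma ge0_mulXS_le a b k : 0 <= a -> 0 <= b -> a * b ^+ k <= a ^+ k.+1 + b ^+ k.+1.
Proof.
move=> a0 b0; have [ab|/ltW ba] := leP a b.
  by apply: ler_wpDl; rewrite ?exprn_ge0// exprS ler_wpM2r// exprn_ge0.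
apply: ler_wpDr; rewrite ?exprn_ge0// exprS ler_wpM2l//.
by apply: lerXn2r; rewrite ?nnegrE.
Qed.

Lemma rearrange_mulX a b k : 0 <= a -> 0 <= b ->
  a * b ^+ k + b * a ^+ k <= a ^+ k.+1 + b ^+ k.+1.
Proof.
move=> a0 b0; rewrite -subr_ge0 !exprS.
rewrite (_ : _ - _ = (a - b) * (a ^+ k - b ^+ k)); last by ring.
have [ab|/ltW ba] := leP a b.
  by rewrite mulr_le0// subr_le0// lerXn2r ?nnegrE.
by rewrite mulr_ge0// subr_ge0// lerXn2r ?nnegrE.
Qed.

Lemma chebyshev_sum r k t : (forall i, 0 <= r i) ->
  (\sum_(i < t) r i) * (\sum_(i < t) r i ^+ k) <= t%:R * \sum_(i < t) r i ^+ k.+1.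
Proof.
move=> r0; elim: t => [|t IH]; first by rewrite !big_ord0 mulr0.
rewrite !big_ord_recr/=; set a := r t.
have : (\sum_(i < t) r i) * a ^+ k + a * \sum_(i < t) r i ^+ k <=
    \sum_(i < t) r i ^+ k.+1 + t%:R * a ^+ k.+1.
  have -> : t%:R * a ^+ k.+1 = \sum_(i < t) a ^+ k.+1.
    by rewrite sumr_const card_ord mulr_natl.
  rewrite mulr_suml mulr_sumr -!big_split/=; apply: ler_sum => i _.
  exact: (rearrange_mulX k (r0 i) (r0 t)).
move: IH; rewrite -(natr1 t) [a ^+ k.+1]exprS.
set A := \sum_(i < t) r i; set B := \sum_(i < t) r i ^+ k.
rewrite !(mulrDl, mulrDr, mul1r); lra.
Qed.

Lemma power_mean_sum r k t : (forall i, 0 <= r i) ->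
  (\sum_(i < t) r i) ^+ k.+1 <= t%:R ^+ k * \sum_(i < t) r i ^+ k.+1.
Proof.
move=> r0; elim: k => [|k IH].
  by rewrite expr0 mul1r expr1; under [leRHS]eq_bigr do rewrite expr1.
rewrite exprS; apply: le_trans (ler_wpM2l _ IH) _; first exact: sumr_ge0.
rewrite mulrCA exprSr -mulrA ler_wpM2l ?exprn_ge0//; exact: chebyshev_sum.
Qed.

(** Controls the drift from the point where the tensor is frozen: the inner sum is the path length
    before step [t]. *)
Lemma cross_sum_le r k T : (forall i, 0 <= r i) ->
  \sum_(t < T) (\sum_(i < t) r i) * r t ^+ k <= T%:R * \sum_(t < T) r t ^+ k.+1.
Proof.
move=> r0; elim: T => [|T IH]; first by rewrite !big_ord0 mulr0.
rewrite !big_ord_recr/= -natr1.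
have : (\sum_(i < T) r i) * r T ^+ k <= \sum_(i < T) r i ^+ k.+1 + T%:R * r T ^+ k.+1.
  have -> : T%:R * r T ^+ k.+1 = \sum_(i < T) r T ^+ k.+1.
    by rewrite sumr_const card_ord mulr_natl.
  rewrite mulr_suml -big_split/=; apply: ler_sum => i _.
  exact: (ge0_mulXS_le k (r0 i) (r0 T)).
have : 0 <= r T ^+ k.+1 by rewrite exprn_ge0.
move: IH; set A := \sum_(t < T) _ * _; set B := \sum_(i < T) r i ^+ _.
rewrite !(mulrDl, mulrDr, mul1r); lra.
Qed.

(** * Linear growth of the decrease over one inner run *)

Section LazyDescent.
(** [r t] is the length of step [t], [F t] the value of [f] before it, [delta] the finite-difference
    error expressed as a distance, and [A] the length scale with [3 * sigma * A ^+ p = eps]. *)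
Context (q m T : nat) (r F : nat -> R) (sigma L delta A : R).
Local Notation p := q.+1.
Local Notation D t := (\sum_(i < t) r i).
Hypotheses (Tm : (T <= m)%N) (m0 : (0 < m)%N) (r0 : forall i, 0 <= r i)
  (L0 : 0 <= L) (sigma0 : 0 < sigma) (delta0 : 0 <= delta) (A0 : 0 <= A)
  (Lsigma : 11 * p.+1%:R * L * m%:R <= sigma)
  (deltaA : delta ^+ p.+1 <= 3 * A ^+ p.+1 / 512)
  (F_step : forall t, (t < T)%N ->
    F t.+1 <= F t + L * (D t + delta) * r t ^+ p / p`!%:R
      - (sigma - L) * r t ^+ p.+1 / (p.+1)`!%:R)
  (A_step : forall t, (t < T)%N ->
    3 * sigma * A ^+ p <= (L + 3 / 2 * sigma) * r t ^+ p
      + p%:R * (L * (D t + delta)) * r t ^+ q).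

Let S := \sum_(t < T) r t ^+ p.+1.

Let mR : 1 <= m%:R :> R. Proof. by rewrite ler1n. Qed.
Let m0' : 0 < m%:R :> R. Proof. by rewrite ltr0n. Qed.

Let D0 t : 0 <= D t. Proof. exact: sumr_ge0. Qed.

Let pL_le : p.+1%:R * L <= sigma / (11 * m%:R).
Proof.
rewrite ler_pdivlMr ?mulr_gt0//; apply: le_trans Lsigma.
by rewrite le_eqVlt; apply/orP; left; apply/eqP; ring.
Qed.

Let L_le : L <= sigma / 22.
Proof.
have p2 : 2 <= p.+1%:R :> R by rewrite ler_nat.
have : 2 * L * 1 <= p.+1%:R * L * m%:R.
  by rewrite ler_pM ?mulr_ge0// ler_wpM2r.
move: Lsigma; rewrite -!mulrA; move: (p.+1%:R * _) => X; lra.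
Qed.

Let fS : (p.+1)`!%:R = p.+1%:R * p`!%:R :> R. Proof. by rewrite factS natrM. Qed.
Let pf : 0 < p`!%:R :> R. Proof. by rewrite ltr0n fact_gt0. Qed.
Let pSf : 0 < (p.+1)`!%:R :> R. Proof. by rewrite ltr0n fact_gt0. Qed.

Let sf0 : 0 <= sigma / (p.+1)`!%:R. Proof. by rewrite divr_ge0// ltW. Qed.

(** Here [19 / 22 = 1 - 1 / 22 - 1 / 11]: the [1 / 22] pays for [L], the [1 / 11] for the [delta]
    term split by [ge0_mulXS_le]. *)
Let step_decrease t : (t < T)%N ->
  sigma / (p.+1)`!%:R * (19 / 22 * r t ^+ p.+1 - D t * r t ^+ p / (11 * m%:R)
     - delta ^+ p.+1 / 11) <= F t - F t.+1.
Proof.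
move=> tT; have rp : 0 <= r t ^+ p by rewrite exprn_ge0.
have rp1 : 0 <= r t ^+ p.+1 by rewrite exprn_ge0.
have Ddc : p.+1%:R * L * ((D t + delta) * r t ^+ p)
    <= sigma / (11 * m%:R) * ((D t + delta) * r t ^+ p).
  by rewrite ler_wpM2r// mulr_ge0// addr_ge0.
have dr : sigma / (11 * m%:R) * (delta * r t ^+ p)
    <= sigma / 11 * (delta ^+ p.+1 + r t ^+ p.+1).
  apply: ler_pM; last exact: ge0_mulXS_le.
  - by rewrite divr_ge0 ?mulr_ge0// ltW.
  - by rewrite mulr_ge0.
  by rewrite ler_wpM2l ?(ltW sigma0)// lef_pV2 ?posrE ?mulr_gt0// ler_peMr.
have La : L * r t ^+ p.+1 <= sigma / 22 * r t ^+ p.+1 by rewrite ler_wpM2r.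
have -> : sigma / (p.+1)`!%:R * (19 / 22 * r t ^+ p.+1 - D t * r t ^+ p / (11 * m%:R)
     - delta ^+ p.+1 / 11) = (19 / 22 * sigma * r t ^+ p.+1
     - sigma / (11 * m%:R) * (D t * r t ^+ p) - sigma / 11 * delta ^+ p.+1) / (p.+1)`!%:R.
  by field; rewrite !gt_eqF.
have FE : ((sigma - L) * r t ^+ p.+1 - p.+1%:R * L * ((D t + delta) * r t ^+ p))
    / (p.+1)`!%:R <= F t - F t.+1.
  have := F_step tT; set X := L * _ * _ / _; set Y := _ * _ / (p.+1)`!%:R.
  rewrite mulrBl -/Y (_ : p.+1%:R * L * _ / _ = X); first lra.
  by rewrite /X fS; field; rewrite !gt_eqF//= addrC natr1 ltr0n.
apply: le_trans FE; rewrite ler_wpM2r ?invr_ge0 ?(ltW pSf)//.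
move: Ddc dr La; rewrite !(mulrDl, mulrDr, mulrBl); lra.
Qed.

(** Telescoping; by [cross_sum_le] and [T <= m] the drift costs at most [S / 11], which lowers
    [19 / 22] to [17 / 22]. *)
Let sum_decrease :
  sigma / (p.+1)`!%:R * (17 / 22 * S - T%:R * delta ^+ p.+1 / 11) <= F 0%N - F T.
Proof.
have -> : F 0%N - F T = \sum_(t < T) (F t - F t.+1).
  elim: (T) => [|k IH]; first by rewrite big_ord0 subrr.
  by rewrite big_ord_recr/= -IH; ring.
apply: le_trans (ler_sum _ (fun t _ => step_decrease (ltn_ord t))).
rewrite -mulr_sumr ler_wpM2l//.
rewrite !sumrB -mulr_sumr -mulr_suml sumr_const card_ord -/S.
have cs := cross_sum_le p T r0.
have : T%:R * S <= m%:R * S.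
  by rewrite ler_wpM2r ?ler_nat// sumr_ge0// => t _; rewrite exprn_ge0.
rewrite -/S in cs; move=> /(le_trans cs) {}cs.
have : (\sum_(t < T) D t * r t ^+ p) / (11 * m%:R) <= S / 11.
  by rewrite ler_pdivrMr ?mulr_gt0// (le_trans cs)//; lra.
rewrite mulr_natl -mulr_natl; lra.
Qed.

(** Since the gradient stays large, either the step itself or the error accumulated before it is
    large: [A] is at most [r t] or [b]. *)
Let step_size t : (t < T)%N ->
  A ^+ p.+1 <= r t ^+ p.+1
    + 2 / 11 * ((\sum_(i < t) r i ^+ p.+1) / m%:R + delta ^+ p.+1).
Proof.
move=> tT; pose b := (D t + delta) / (11 * m%:R).
have m11 : 0 < 11 * m%:R :> R by rewrite mulr_gt0.
have b0 : 0 <= b by rewrite divr_ge0 ?addr_ge0// ltW.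
have St0 : 0 <= \sum_(i < t) r i ^+ p.+1 by apply: sumr_ge0 => i _; rewrite exprn_ge0.
have d0 : 0 <= delta ^+ p.+1 by rewrite exprn_ge0.
have bp : b ^+ p.+1 <= 2 / 11 * ((\sum_(i < t) r i ^+ p.+1) / m%:R + delta ^+ p.+1).
  (* [b] is at most [2 / 11] of the larger of [D t / m] and [delta]. The power mean inequality with
     [t <= m] treats the former, and the power of [2 / 11] is at most [2 / 11]. *)
  pose M := Num.max (D t / m%:R) delta.
  have M0 : 0 <= M by rewrite le_max delta0 orbT.
  have bM : b <= 2 / 11 * M.
    have -> : b = 1 / 11 * (D t / m%:R + delta / m%:R) by rewrite /b; field; rewrite gt_eqF.
    have : D t / m%:R <= M by rewrite le_max lexx.
    have : delta / m%:R <= M.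
      by apply: (@le_trans _ _ delta); rewrite ?le_max ?lexx ?orbT// ler_pdivrMr// ler_peMr.
    lra.
  have : b ^+ p.+1 <= (2 / 11 * M) ^+ p.+1.
    by rewrite lerXn2r ?nnegrE//; apply: mulr_ge0 => //; rewrite divr_ge0.
  move=> /le_trans; apply; rewrite exprMn; apply: ler_pM; rewrite ?exprn_ge0//.
    by rewrite exprS ler_piMr// exprn_ile1//; lra.
  rewrite /M; have [_|_] := leP (D t / m%:R) delta.
    by rewrite lerDr divr_ge0// ltW.
  apply: ler_wpDr => //; rewrite exprMn exprVn ler_pdivrMr ?exprn_gt0//.
  apply: le_trans (power_mean_sum q.+1 t r0) _.
  rewrite [leRHS](_ : _ = m%:R ^+ p * \sum_(i < t) r i ^+ p.+1); last first.
    by rewrite [m%:R ^+ p.+1]exprS; field; rewrite gt_eqF.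
  rewrite ler_wpM2r// lerXn2r ?nnegrE// ler_nat.
  exact: leq_trans (ltnW tT) Tm.
(* If [r t] and [b] were both below [A], the right side of [A_step] would be less than
   [2 * sigma * A ^+ p + sigma * A ^+ p]. *)
have Arb : (A <= r t) || (A <= b).
  rewrite -[_ || _]negbK negb_or -!ltNge; apply/negP => /andP[rA bA].
  have Apos : 0 < A := le_lt_trans b0 bA.
  have rAp : r t ^+ p < A ^+ p by rewrite ltrXn2r// nnegrE.
  have bAp : b * r t ^+ q <= A ^+ p.
    by rewrite exprS ler_pM ?exprn_ge0// ?lerXn2r ?nnegrE// ltW.
  have := A_step tT; apply/negP; rewrite -ltNge.
  have h1 : (L + 3 / 2 * sigma) * r t ^+ p <= 2 * sigma * r t ^+ p.
    by rewrite ler_wpM2r ?exprn_ge0//; move: L_le sigma0; lra.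
  have h2 : p%:R * (L * (D t + delta)) * r t ^+ q <= sigma * (b * r t ^+ q).
    rewrite mulrA [leRHS]mulrA ler_wpM2r ?exprn_ge0// /b.
    apply: (@le_trans _ _ (p.+1%:R * L * (D t + delta))).
      by rewrite ler_wpM2r ?addr_ge0// ler_wpM2r// ler_nat.
    by rewrite [leRHS]mulrA [leRHS]mulrAC ler_wpM2r ?addr_ge0.
  have h3 : sigma * (b * r t ^+ q) <= sigma * A ^+ p by rewrite ler_wpM2l// ltW.
  have h4 : sigma * r t ^+ p < sigma * A ^+ p by rewrite ltr_pM2l.
  lra.
case/orP: Arb => [Ar|Ab].
  apply: ler_wpDr; first by rewrite mulr_ge0// addr_ge0// divr_ge0// ltW.
  by rewrite lerXn2r ?nnegrE.
apply: ler_wpDl; first by rewrite exprn_ge0.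
by apply: le_trans bp; rewrite lerXn2r ?nnegrE.
Qed.

(** Each of the [T <= m] inner sums is at most [S], so after division by [m] they raise the
    coefficient of [S] from 1 to [13 / 11]. *)
Let sum_size : T%:R * A ^+ p.+1 <= 13 / 11 * S + 2 / 11 * (T%:R * delta ^+ p.+1).
Proof.
have : \sum_(t < T) A ^+ p.+1 <= \sum_(t < T) (r t ^+ p.+1
    + 2 / 11 * ((\sum_(i < t) r i ^+ p.+1) / m%:R + delta ^+ p.+1)).
  by apply: ler_sum => t _; exact: step_size.
rewrite sumr_const card_ord -mulr_natl big_split/= -/S -mulr_sumr big_split/=.
rewrite sumr_const card_ord -[delta ^+ _ *+ _]mulr_natl -mulr_suml.
have S0 : 0 <= S by apply: sumr_ge0 => t _; rewrite exprn_ge0.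
have : (\sum_(t < T) \sum_(i < t) r i ^+ p.+1) / m%:R <= S.
  rewrite ler_pdivrMr//; apply: (@le_trans _ _ (\sum_(t < T) S)).
    apply: ler_sum => t _; rewrite /S.
    rewrite (big_ord_widen T (fun i => r i ^+ p.+1) (ltnW (ltn_ord t))).
    rewrite [leRHS](bigID (fun i : 'I_T => (i < t)%N))/=.
    by rewrite lerDl sumr_ge0// => i _; rewrite exprn_ge0.
  by rewrite sumr_const card_ord -[S *+ T]mulr_natr ler_wpM2l// ler_nat.
lra.
Qed.

(** Eliminating [S] between [sum_size] and [sum_decrease] leaves a coefficient [17 / 26], reduced
    only slightly by the [delta] terms, against the required [3 / 64]. *)
Lemma lazy_descent :
  sigma * T%:R * (3 * A ^+ p.+1) / (64 * (p.+1)`!%:R) <= F 0%N - F T.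
Proof.
apply: le_trans sum_decrease.
have -> : sigma * T%:R * (3 * A ^+ p.+1) / (64 * (p.+1)`!%:R)
    = sigma / (p.+1)`!%:R * (3 / 64 * (T%:R * A ^+ p.+1)).
  by rewrite invfM; ring.
rewrite ler_wpM2l//.
have : T%:R * delta ^+ p.+1 <= T%:R * (3 * A ^+ p.+1 / 512) by rewrite ler_wpM2l.
have := sum_size; have : 0 <= T%:R * A ^+ p.+1 by rewrite mulr_ge0// exprn_ge0.
lra.
Qed.

End LazyDescent.
End DescentSum.

(** * The inner loop *)

Section Roots.
Context {R : realType} (q : nat).
Local Notation p := q.+1.
Implicit Type x : R.

Lemma powR_invnK x : 0 <= x -> (x `^ p%:R^-1) ^+ p = x.
Proof.
move=> x0; rewrite -powR_mulrn ?powR_ge0// -powRrM mulVf ?powRr1//.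
Qed.

Lemma powR_succn_div x : 0 <= x -> x `^ (p.+1%:R / p%:R) = x * x `^ p%:R^-1.
Proof.
move=> x0; have p0 : p%:R != 0 :> R by rewrite pnatr_eq0.
have -> : p.+1%:R / p%:R = 1 + p%:R^-1 :> R by rewrite -natr1; field.
rewrite powRD ?powRr1//; apply/implyP => /eqP/esym/eqP.
by rewrite lt_eqF// ltr_pwDl// invr_ge0.
Qed.

Lemma powR_invn_mul_predn (m : nat) : (0 < m)%N ->
  m%:R `^ (q%:R / p%:R) * m%:R `^ p%:R^-1 = m%:R :> R.
Proof.
move=> m0; have p0 : p%:R != 0 :> R by rewrite pnatr_eq0.
have m0' : m%:R != 0 :> R by rewrite pnatr_eq0 -lt0n.
rewrite -powRD; last by apply/implyP.
have -> : q%:R / p%:R + p%:R^-1 = 1 :> R.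
  by rewrite -[X in _ + X]mul1r -mulrDl natr1 divff.
by rewrite powRr1.
Qed.

End Roots.

Section Lazy.
Context {R : realType} {n q : nat}.
Local Notation V := 'rV[R]_n.
Local Notation p := q.+1.
Context (f : V -> R) (L eps : R) (m : nat).
Hypothesis df : forall s, (size s < p)%N -> forall x, differentiable (dir_deriv f s) x.
Hypothesis lip : forall s x y, size s = p ->
  `|dir_deriv f s x - dir_deriv f s y| <= L * enorm (x - y) * \prod_(a <- s) enorm a.
Hypotheses (n0 : (0 < n)%N) (m0 : (0 < m)%N) (L0 : 0 <= L) (eps0 : 0 < eps).

Definition step_gain (sigma : R) : R :=
  eps `^ (p.+1%:R / p%:R)
  / (2 ^+ 6 * 3 `^ p%:R^-1 * sigma `^ p%:R^-1 * (p.+1)`!%:R).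

Lemma step_gain_ge0 sigma : 0 <= step_gain sigma.
Proof. by rewrite divr_ge0 ?powR_ge0// !mulr_ge0 ?powR_ge0. Qed.

(** A run with the tensor frozen at [x0] in which no step reaches a small gradient. The decrease
    test is left out because it is to be derived from these data. *)
Definition lazy_path (x0 : V) (sigma : R) (T : nat) (X : nat -> V) : Prop :=
  X 0%N = x0 /\ forall t, (t < T)%N ->
    tensor_step f (fd_form f (fd_stepsize (n := n) p eps sigma) x0 : p.-tuple V -> R) sigma
      (X t) (X t.+1) /\ eps < enorm (grad f (X t.+1)).

Lemma fd_stepsize_gt0 sigma : 0 < sigma -> 0 < fd_stepsize (n := n) p eps sigma.
Proof.
move=> s0; have n0' : 0 < Num.sqrt n%:R :> R by rewrite sqrtr_gt0 ltr0n.
rewrite /fd_stepsize mulr_gt0 ?divr_gt0 ?mulr_gt0 ?powR_gt0//.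
by rewrite divr_gt0 ?mulr_gt0 ?exprn_gt0 ?powR_gt0// ?mulr_gt0 ?ltr0n.
Qed.

(** The step size is made for this: it is the hypothesis [deltaA] of [lazy_descent], the right side
    being [3 * A ^+ p.+1 / 512]. *)
Lemma fd_stepsize_le sigma : 0 < sigma ->
  (Num.sqrt n%:R * fd_stepsize (n := n) p eps sigma / 2) ^+ p.+1
  <= eps `^ (p.+1%:R / p%:R) / (512 * sigma * (3 `^ p%:R^-1 * sigma `^ p%:R^-1)).
Proof.
move=> s0; have n0' : 0 < Num.sqrt n%:R :> R by rewrite sqrtr_gt0 ltr0n.
rewrite /fd_stepsize.
set E := eps `^ _; set c := 3 `^ _; set s := sigma `^ _.
have c0 : 0 < c by rewrite powR_gt0.
have s0' : 0 < s by rewrite powR_gt0.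
have E0 : 0 < E by rewrite powR_gt0.
set W := (X in X `^ _).
have W0 : 0 <= W.
  by rewrite /W divr_ge0 ?mulr_ge0 ?exprn_ge0 ?mulr_ge0 ?ler0n// ltW.
have -> : Num.sqrt n%:R * (4 / (sigma * Num.sqrt n%:R) * W `^ p.+1%:R^-1) / 2
    = 2 / sigma * W `^ p.+1%:R^-1 by field; rewrite !gt_eqF.
rewrite exprMn powR_invnK// /W {W W0}.
set N := (8 * p.+1%:R) ^+ p.
have p2 : 2 <= p.+1%:R :> R by rewrite ler_nat.
have N0 : 0 < N by rewrite exprn_gt0// mulr_gt0// ltr0n.
(* The step size itself provides [2 ^+ 7 = 128]; this supplies the missing factor 4 and absorbs
   [2 ^+ p.+1]. *)
have N_ge : 4 * 2 ^+ p.+1 <= N.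
  rewrite /N (_ : 8 * p.+1%:R = 2 * (4 * p.+1%:R)); last by ring.
  rewrite exprMn exprSr mulrCA ler_wpM2l ?exprn_ge0//.
  by apply: (@le_trans _ _ (4 * p.+1%:R)); [|apply: ler_eXnr => //]; lra.
have -> : (2 / sigma) ^+ p.+1 * (sigma ^+ p * E / (N * 2 ^+ 7 * c * s))
    = E / (sigma * (c * s)) * (2 ^+ p.+1 / (N * 128)).
  rewrite exprMn exprVn [sigma ^+ p.+1]exprS (_ : 2 ^+ 7 = 128); last by ring.
  have sp : sigma ^+ p != 0 by rewrite expf_neq0 ?gt_eqF.
  move: sp; move: (sigma ^+ p) (2 ^+ p.+1) => a b a0.
  by field; rewrite a0 !gt_eqF.
have -> : E / (512 * sigma * (c * s)) = E / (sigma * (c * s)) * (1 / 512).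
  by field; rewrite !gt_eqF.
rewrite ler_wpM2l//; first by rewrite divr_ge0 ?mulr_ge0// ltW.
rewrite ler_pdivrMr ?mulr_gt0//; lra.
Qed.

Lemma lazy_path_gain x0 sigma T X : 0 < sigma ->
  11 * p.+1%:R * L * m%:R <= sigma -> (T <= m)%N -> lazy_path x0 sigma T X ->
  step_gain sigma * T%:R <= f x0 - f (X T).
Proof.
move=> s0 Ls Tm [X0 XT].
pose h := fd_stepsize (n := n) p eps sigma; pose delta := Num.sqrt n%:R * h / 2.
have h0 : 0 < h by exact: fd_stepsize_gt0.
have delta0 : 0 <= delta.
  by apply: divr_ge0 => //; apply: mulr_ge0; [exact: sqrtr_ge0|exact: ltW].
pose r t := enorm (X t.+1 - X t).
have r0 t : 0 <= r t by exact: enorm_ge0.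
have dist t : enorm (x0 - X t) <= \sum_(i < t) r i.
  elim: t => [|t IH]; first by rewrite X0 subrr enorm0 big_ord0.
  rewrite big_ord_recr/= -(subrK (X t) x0) -addrA (le_trans (enormD _ _))//.
  by rewrite lerD// -enormN opprB.
have D0 t : 0 <= \sum_(i < t) r i by exact: sumr_ge0.
pose G := fd_multi f h x0.
have Gm : multilinear p G by exact: fd_multi_multilinear.
have TG v := fd_form_diag f (q := q) h x0 v.
(* The finite-difference error at [x0], plus the Lipschitz bound over the distance from [x0] to
   [X t]. *)
have GK t s : size s = p ->
    `|G s - dir_deriv f s (X t)| <=
    L * (\sum_(i < t) r i + delta) * \prod_(a <- s) enorm a.
  move=> sp; have P0 : 0 <= \prod_(a <- s) enorm a.
    by apply: prodr_ge0 => a _; exact: enorm_ge0.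
  rewrite -(subrK (dir_deriv f s x0) (G s)) -addrA (le_trans (ler_normD _ _))//.
  rewrite [leRHS](_ : _ = L * delta * \prod_(a <- s) enorm a +
     L * (\sum_(i < t) r i) * \prod_(a <- s) enorm a); last by ring.
  apply: lerD; first exact: (fd_multi_error df lip x0 h0 sp L0).
  by apply: le_trans (lip _ _ sp) _; rewrite ler_wpM2r// ler_wpM2l.
have K0 t : 0 <= L * (\sum_(i < t) r i + delta) by rewrite mulr_ge0// addr_ge0.
pose A := eps `^ p%:R^-1 / (3 `^ p%:R^-1 * sigma `^ p%:R^-1).
have A0 : 0 <= A by rewrite divr_ge0 ?mulr_ge0 ?powR_ge0.
have c0 : 0 < 3 `^ p%:R^-1 :> R by rewrite powR_gt0.
have s0' : 0 < sigma `^ p%:R^-1 by rewrite powR_gt0.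
have Ap : 3 * sigma * A ^+ p = eps.
  rewrite /A expr_div_n exprMn !powR_invnK// ?(ltW s0) ?(ltW eps0)//.
  by field; rewrite gt_eqF.
have Ap1 : 3 * A ^+ p.+1 =
    eps `^ (p.+1%:R / p%:R) / (sigma * (3 `^ p%:R^-1 * sigma `^ p%:R^-1)).
  have Ap' : A ^+ p = eps / (3 * sigma) by rewrite -[in RHS]Ap; field; rewrite gt_eqF.
  rewrite powR_succn_div ?(ltW eps0)// exprS Ap' /A.
  by field; rewrite !gt_eqF.
have := @lazy_descent R q m T r (f \o X) sigma L delta A Tm m0 r0 L0 s0 delta0 A0 Ls.
rewrite /= X0.
have -> : step_gain sigma * T%:R = sigma * T%:R * (3 * A ^+ p.+1) / (64 * (p.+1)`!%:R).
  rewrite Ap1 /step_gain (_ : 2 ^+ 6 = 64); last by ring.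
  field; rewrite !gt_eqF// ltr0n fact_gt0.
apply.
- rewrite Ap1; apply: le_trans (fd_stepsize_le s0) _.
  by rewrite le_eqVlt; apply/orP; left; apply/eqP; field; rewrite !gt_eqF.
- move=> t tT; have [Xs _] := XT t tT.
  exact: (tensor_step_value df lip TG (GK t) Xs).
move=> t tT; have [Xs Xe] := XT t tT; rewrite Ap.
apply: le_trans (tensor_step_grad df lip Gm TG (GK t) L0 (K0 t) s0 Xs).
have f1 : 1 <= p`!%:R :> R by rewrite ler1n fact_gt0.
apply: (le_trans (ltW Xe)); by rewrite ler_peMl// enorm_ge0.
Qed.

(** Induction on the execution; the invariant is a path of [t] steps to [x] together with the
    decrease at the best point. For large [sigma] a halt would contradict [lazy_path_gain]. *)
Lemma lazy_loop_outcome x0 sigma t x xt z a : 0 < sigma ->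
  lazy_loop f x0 (fd_form f (fd_stepsize (n := n) p eps sigma) x0 : p.-tuple V -> R) sigma m eps
    t x xt z a ->
  (t <= m)%N -> (exists2 X, lazy_path x0 sigma t X & X t = x) ->
  step_gain sigma * t%:R <= f x0 - f xt ->
  match a return Prop with
  | Success => step_gain sigma * m%:R <= f x0 - f z
  | Solution => enorm (grad f z) <= eps
  | Halt => f z <= f x0 /\ sigma < 11 * p.+1%:R * L * m%:R
  end.
Proof.
move=> s0.
have extend t' y x' X : lazy_path x0 sigma t' X -> X t' = y ->
    tensor_step f (fd_form f (fd_stepsize (n := n) p eps sigma) x0 : p.-tuple V -> R) sigma y x' ->
    ~ enorm (grad f x') <= eps ->
    lazy_path x0 sigma t'.+1 (fun i => if (i <= t')%N then X i else x').
  move=> [X0 Xs] Xt ts /negP; rewrite -ltNge => ge; split; first by rewrite leq0n.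
  move=> i; rewrite ltnS leq_eqVlt => /orP[/eqP ->|it].
    by rewrite eqxx ltnn Xt.
  by rewrite it orbT; exact: Xs.
elim=> {t x xt z a} [x xt|t x xt x' xt' _ _ _ //|
    t x xt x' xt' tm ts [_ [fxt fx']] ng nd|t x xt x' xt' z a tm ts [_ [fxt fx']] ng sd _ IH]
    tlem [X Xp Xt] gain //.
- split.
    apply: le_trans fxt _; rewrite -subr_ge0; apply: le_trans gain.
    by rewrite mulr_ge0 ?step_gain_ge0.
  rewrite ltNge; apply/negP => Ls; apply: nd.
  have tm' : (t.+1 <= m)%N by rewrite ltn_neqAle tlem andbT; apply/eqP.
  have := lazy_path_gain s0 Ls tm' (extend _ _ _ _ Xp Xt ts ng).
  rewrite ltnn => /le_trans; apply; exact: lerB.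
apply: IH => //; first by rewrite ltn_neqAle tlem andbT; apply/eqP.
by apply: ex_intro2 (extend _ _ _ _ Xp Xt ts ng) _; rewrite ltnn.
Qed.

End Lazy.

(** * The outer loop *)

Section Outer.
Context {R : realType} {n q : nat}.
Local Notation V := 'rV[R]_n.
Local Notation p := q.+1.
Context (f : V -> R) (L eps : R) (m : nat).
Hypothesis df : forall s, (size s < p)%N -> forall x, differentiable (dir_deriv f s) x.
Hypothesis lip : forall s x y, size s = p ->
  `|dir_deriv f s x - dir_deriv f s y| <= L * enorm (x - y) * \prod_(a <- s) enorm a.
Hypotheses (n0 : (0 < n)%N) (m0 : (0 < m)%N) (Lge0 : 0 <= L) (eps0 : 0 < eps).

(** Bounds from below the gain of [m] steps while [Lk <= Lmax]: dividing [m] by the [m^(1/p)]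
    contained in [sigma^(1/p)] leaves the exponent [(p-1)/p]. *)
Definition outer_gain (Lmax : R) : R :=
  eps `^ (p.+1%:R / p%:R) * m%:R `^ (q%:R / p%:R)
  / (2 ^+ 6 * 3 `^ p%:R^-1 * (11 * p.+1%:R * Lmax) `^ p%:R^-1 * (p.+1)`!%:R).

Lemma outer_gain_gt0 Lmax : 0 < Lmax -> 0 < outer_gain Lmax.
Proof.
move=> l0; rewrite divr_gt0 ?mulr_gt0 ?powR_gt0 ?exprn_gt0 ?ltr0n ?fact_gt0//.
by rewrite !mulr_gt0// ltr0n.
Qed.

Lemma outer_gain_le Lk Lmax : 0 < Lk -> Lk <= Lmax ->
  outer_gain Lmax <= step_gain (q := q) eps (sigma_of p m Lk) * m%:R.
Proof.
move=> k0 kM; have M0 := lt_le_trans k0 kM.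
have c11 : 0 < 11 * p.+1%:R :> R by rewrite mulr_gt0// ltr0n.
have lk0 : 0 < 11 * p.+1%:R * Lk by rewrite mulr_gt0.
have lM0 : 0 < 11 * p.+1%:R * Lmax by rewrite mulr_gt0.
have mp : 0 < m%:R `^ p%:R^-1 :> R by rewrite powR_gt0// ltr0n.
rewrite /outer_gain /step_gain /sigma_of [(_ * m%:R) `^ _]powRM ?(ltW lk0)//.
rewrite -[X in _ <= _ * X](powR_invn_mul_predn q m0).
have le : (11 * p.+1%:R * Lk) `^ p%:R^-1 <= (11 * p.+1%:R * Lmax) `^ p%:R^-1.
  by rewrite ge0_ler_powR ?nnegrE ?invr_ge0 ?(ltW lk0) ?(ltW lM0)// ler_wpM2l// ltW.
have ak : 0 < (11 * p.+1%:R * Lk) `^ p%:R^-1 by rewrite powR_gt0.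
have aM : 0 < (11 * p.+1%:R * Lmax) `^ p%:R^-1 by rewrite powR_gt0.
have c0 : 0 < 3 `^ p%:R^-1 :> R by rewrite powR_gt0.
have ff : 0 < (p.+1)`!%:R :> R by rewrite ltr0n fact_gt0.
move: mp c0 ff ak aM le.
set a := (_ * Lk) `^ _; set b := (_ * Lmax) `^ _; set c := 3 `^ _; set d := _`!%:R.
set E := eps `^ _; set u := m%:R `^ (_ / _); set w := m%:R `^ _ => w0 c0 d0 a0 b0 ab.
rewrite [leRHS](_ : _ = E * u / (2 ^+ 6 * c * a * d)); last by field; rewrite !gt_eqF.
rewrite ler_wpM2l ?mulr_ge0 ?powR_ge0//.
rewrite lef_pV2 ?posrE ?mulr_gt0 ?exprn_gt0//.
by rewrite ler_wpM2r ?(ltW d0)// ler_wpM2l// mulr_ge0 ?exprn_ge0// ltW.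
Qed.

Context (z0 : V) (L0 : R) (z : nat -> V) (Ls : nat -> R).
Hypotheses (L00 : 0 < L0) (run : outer_run f p eps m z0 L0 z Ls).
Let Lmax := Num.max L0 (2 * L).

(** [nS] and [nH] count the successes and the halts among the first [k] inner runs. *)
Lemma outer_invariant k :
  (forall j, (j <= k)%N -> ~ enorm (grad f (z j)) <= eps) ->
  exists nS nH : nat, [/\ (nS + nH)%N = k, Ls k * 2 ^+ nS = L0 * 2 ^+ nH,
    0 < Ls k, Ls k <= Lmax & outer_gain Lmax * nS%:R <= f z0 - f (z k)].
Proof.
have [zz0 [Ls0 step]] := run.
have Lmax0 : 0 < Lmax by rewrite lt_max L00.
elim: k => [_|k IH ng].
  by exists 0%N, 0%N; rewrite zz0 Ls0 subrr mulr0 le_max lexx.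
have ngk j : (j <= k)%N -> ~ enorm (grad f (z j)) <= eps.
  by move=> jk; apply: ng; exact: leqW.
have [nS [nH [nE LE Lk0 LkM gain]]] := IH ngk.
have [a [loop LS]] := step k ngk.
have s0 : 0 < sigma_of p m (Ls k) by rewrite !mulr_gt0// ltr0n.
have := @lazy_loop_outcome R n q f L eps m df lip n0 m0 Lge0 eps0 (z k) _ 0 _ _ _ _ s0 loop.
rewrite mulr0 subrr => /(_ (leq0n m)) outc.
have path0 : exists2 X, lazy_path (q := q) f eps (z k) (sigma_of p m (Ls k)) 0 X & X 0%N = z k.
  by exists (fun=> z k).
have {}outc := outc path0 (lexx 0).
move: outc; clear loop; case: a LS => /= LS outc.
- exists nS.+1, nH; rewrite LS; split => //.
  + by rewrite addSn nE.
  + by rewrite exprS mulrA divfK.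
  + by rewrite divr_gt0.
  + by apply: le_trans LkM; rewrite ler_pdivrMr// ler_peMr ?ler1n// ltW.
  + have := le_trans (outer_gain_le Lk0 LkM) outc.
    by rewrite -natr1 mulrDr mulr1; lra.
(* The outcome [Solution] would make the gradient small at [k.+1]. *)
- by case: (ng k.+1 (leqnn _)).
have [fz sL] := outc; exists nS, nH.+1; rewrite LS; split => //.
+ by rewrite addnS nE.
+ by rewrite -mulrA LE exprS mulrCA.
+ by rewrite mulr_gt0.
(* A halt forces [Ls k < L], so doubling stays below [2 * L]. *)
+ rewrite le_max; apply/orP; right; rewrite ler_wpM2l//.
  move: sL; rewrite /sigma_of ltr_pM2r ?ltr0n// ltr_pM2l ?mulr_gt0 ?ltr0n//.
  exact: ltW.
by apply: le_trans gain _; rewrite lerB.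
Qed.

(** The total decrease bounds [nS], and [Ls k <= Lmax] bounds [nH] by [nS] plus the logarithm.
    Counting [nS] twice gives the factor 2 that turns [2 ^+ 6] into [2 ^+ 7]. *)
Lemma termination_bound k f_low : (forall x, f_low <= f x) ->
  (forall j, (j <= k)%N -> ~ enorm (grad f (z j)) <= eps) ->
  k%:R <= 2 * (f z0 - f_low) / outer_gain Lmax + log2 (Lmax / L0).
Proof.
move=> flow ng; have [nS [nH [nE LE Lk0 LkM gain]]] := outer_invariant ng.
have Lmax0 : 0 < Lmax by rewrite lt_max L00.
have g0 : 0 < outer_gain Lmax by exact: outer_gain_gt0.
have SE : nS%:R <= (f z0 - f_low) / outer_gain Lmax.
  by rewrite ler_pdivlMr// mulrC (le_trans gain)// lerB.
have l2 : 0 < ln 2 :> R by rewrite ln_gt0// ltr1n.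
have HE : nH%:R <= nS%:R + log2 (Lmax / L0).
  rewrite -lerBlDl /log2 ler_pdivlMr// mulrBl !mulr_natl.
  rewrite -!lnXn// -ln_div ?posrE ?exprn_gt0//.
  rewrite ler_ln ?posrE ?divr_gt0 ?exprn_gt0//.
  rewrite ler_pdivrMr ?exprn_gt0// mulrAC ler_pdivlMr// mulrC -LE.
  by rewrite ler_wpM2r ?exprn_ge0.
by rewrite -nE natrD -mulrA; lra.
Qed.

End Outer.

(** * From indices with a large gradient to the termination time *)

Theorem theorem3p5 (R : realType) (n p : nat) (hp : (1 <= p)%N)
  (f : 'rV[R]_n -> R) (L f_low : R)
  (f_diff : times_differentiable p f)
  (f_lip : forall x y : 'rV[R]_n,
     opnorm (fun h => nabla p f x h - nabla p f y h) <= L * enorm (x - y))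
  (f_bound : forall x : 'rV[R]_n, f_low <= f x)
  (eps : R) (eps_gt0 : 0 < eps) (z0 : 'rV[R]_n) (L0 : R) (L0_gt0 : 0 < L0)
  (m : nat) (m_gt0 : (0 < m)%N)
  (z : nat -> 'rV[R]_n) (Ls : nat -> R)
  (run : outer_run f p eps m z0 L0 z Ls) :
  let L_max := Num.max L0 (2 * L) in
  (termination_time f eps z <=
    (1
     + 2 ^+ 7 * (3 * 11 * p.+1%:R * L_max) `^ p%:R^-1 * (p.+1)`!%:R
         * (f z0 - f_low) / m%:R `^ (p.-1%:R / p%:R)
         * eps `^ (- (p.+1%:R / p%:R))
     + log2 (L_max / L0))%:E)%E.
Proof.
cbv zeta; set Lmax := Num.max _ _.
case: p hp f_diff f_lip run => [//|q] _ f_diff f_lip run.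
have Lmax0 : 0 < Lmax by rewrite lt_max L0_gt0.
rewrite powRN /=.
set B := (X in X%:E).
pose gain := outer_gain (q := q) eps m Lmax.
have gain0 : 0 < gain by exact: outer_gain_gt0.
have BE : B = 1 + 2 * (f z0 - f_low) / gain + log2 (Lmax / L0).
  rewrite /B; congr (_ + _ + _); rewrite /gain /outer_gain.
  have l0 : 0 <= 11 * q.+2%:R * Lmax by rewrite !mulr_ge0// ltW.
  rewrite (_ : 3 * 11 * q.+2%:R * Lmax = 3 * (11 * q.+2%:R * Lmax)); last by ring.
  rewrite [(3 * _) `^ _]powRM//.
  have mp : 0 < m%:R `^ (q%:R / q.+1%:R) :> R by rewrite powR_gt0// ltr0n.
  have ep : 0 < eps `^ (q.+2%:R / q.+1%:R) by rewrite powR_gt0.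
  have ff : (q.+2)`!%:R != 0 :> R by rewrite pnatr_eq0 -lt0n fact_gt0.
  rewrite !invfM !invrK (_ : 2 ^+ 7 = 2 * 2 ^+ 6); last by rewrite exprS.
  ring.
have stop k : enorm (grad f (z k)) <= eps -> k%:R <= B ->
    (termination_time f eps z <= B%:E)%E.
  move=> zk kB; apply: (@le_trans _ _ k%:R%:E); last by rewrite lee_fin.
  by apply: ereal_inf_lbound; exists k.
have [z0e|/negP] := boolP (enorm (grad f (z 0%N)) <= eps).
  apply: (stop 0%N) => //; rewrite BE !addr_ge0//.
    by rewrite divr_ge0 ?(ltW gain0)// mulr_ge0// subr_ge0.
  have L1 : 1 <= Lmax / L0 by rewrite ler_pdivlMr// mul1r le_max lexx.
  by rewrite /log2 divr_ge0// ln_ge0// ler1n.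
move=> ng0.
(* In dimension 0 the gradient has norm 0 and the method stops at once. *)
have n0 : (0 < n)%N.
  rewrite lt0n; apply/eqP => nE; apply: ng0.
  rewrite (_ : enorm _ = 0) ?(ltW eps_gt0)// /enorm /dot.
  rewrite big1 ?sqrtr0// => i _; exfalso.
  by have := ltn_ord i; rewrite [X in (_ < X)%N]nE.
have df := times_differentiable_dir_deriv f_diff.
have lip s x y : size s = q.+1 -> `|dir_deriv f s x - dir_deriv f s y|
    <= L * enorm (x - y) * \prod_(a <- s) enorm a.
  move=> sq; have P0 : 0 <= \prod_(a <- s) enorm a.
    by apply: prodr_ge0 => a _; exact: enorm_ge0.
  apply: le_trans (ler_wpM2r P0 (f_lip x y)).
  apply: (le_opnorm (F := fun s => dir_deriv f s x - dir_deriv f s y)) => //.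
    by apply: multilinearB; exact: (dir_deriv_multilinear df _ (leqnn _)).
  by move=> h; rewrite !nabla_dir_deriv.
have Lge0 : 0 <= L.
  have := le_trans (opnorm_ge0 _) (f_lip (basis_vec (Ordinal n0)) 0).
  by rewrite subr0 enorm_basis mulr1.
(* [termination_bound] estimates [k] without the summand 1 of [B], which pays for the passage to
   [k.+1]. *)
have bound k : (forall j, (j <= k)%N -> ~ enorm (grad f (z j)) <= eps) -> k.+1%:R <= B.
  move=> ng; rewrite -natr1 BE.
  have := termination_bound df lip n0 m_gt0 Lge0 eps_gt0 L0_gt0 run f_bound ng.
  by rewrite -/Lmax -/gain; lra.
have [[K]|none] := pselect (exists k, enorm (grad f (z k)) <= eps); last first.
  (* If the method never stopped, [bound] at the integer part of [B] would be contradictory. *)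
  have := bound (Num.truncn B) (fun j _ zj => none (ex_intro _ j zj)).
  by rewrite leNgt truncnS_gt.
(* Descent to the first index with a small gradient, where [bound] applies to its predecessor. *)
elim/ltn_ind: K => -[//|K] IH zK.
have [/existsP[[j jK] zj]|] := boolP [exists j : 'I_K.+1, enorm (grad f (z j)) <= eps].
  exact: IH zj.
move=> /existsPn none; apply: (stop K.+1 zK (bound K _)) => j jK.
exact/negP/(none (Ordinal (jK : (j < K.+1)%N))).
Qed.
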